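(* Let $U$ be a $2\times 2$ unitary matrix and let $\{A_n\}$ be a unital measurement on the coin space. Suppose that for every $k\in[0,2\pi]$ the number $1$ is an eigenvalue of $\mathcal{L}_{k,k}$ with multiplicity one, and every other eigenvalue $\lambda$ of $\mathcal{L}_{k,k}$ satisfies $|\lambda|<1$. Then for all $\nu\in[0,2\pi]$, $$\lim_{t\to\infty}\hat P\Big(\frac{\nu}{\sqrt t},t\Big)=\frac{1}{2\pi}\int_0^{2\pi}e^{-\frac12 z_0''(0)\nu^2}\,dk,$$ where, for each $k$, $z_0(\nu)=z_0(\nu;k)$ is the root of $\det(1-z\mathcal{L}_{k,k+\nu})=0$ (as an equation in $z$, for $\nu$ near $0$, depending continuously on $\nu$) such that $z_0(0)=1$, and $z_0''(0)$ is its second derivative in $\nu$ at $\nu=0$.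
   Context: Setting (decoherent quantum walk on the line). The state space is $H_p\otimes H_2$, where $H_p$ has basis $|x\rangle$, $x\in\mathbb{Z}$, and the coin space $H_2=\mathbb{C}^2$ has orthonormal basis $|R\rangle,|L\rangle$ (in this order for matrices). $P_R,P_L$ are the orthogonal projections onto the spans of $|R\rangle$, $|L\rangle$. $S^{\pm}|x\rangle=|x\pm1\rangle$. $U$ is a unitary operator on $H_2$ and one step of the walk is $E=(S^+\otimes P_R+S^-\otimes P_L)(I\otimes U)$. For real $k$, $U_k=(e^{-ik}P_R+e^{ik}P_L)U$. Decoherence: $\{A_n\}$ is a (finite) set of operators on $H_2$ with $\sum_n A_n^*A_n=I$; it is called unital if also $\sum_n A_nA_n^*=I$. Before each step a coin density operator $\chi$ is replaced by $\sum_n A_n\chi A_n^*$. Thus one step maps a density operator $\rho$ to $\sum_n E(I\otimes A_n)\rho(I\otimes A_n)^*E^*$. The walk starts at $|0\rangle\otimes|\Phi_0\rangle$ with $\Phi_0\in H_2$ a unit vector; $\rho_t$ is the state after $t$ steps and $p(x,t)=\mathrm{Tr}\{(|x\rangle\langle x|\otimes I)\rho_t\}$ is the probability of position $x$ at time $t$. Let $L(H_2)$ be the ($4$-dimensional) space of linear operators on $H_2$. The superoperator $\mathcal{L}_{k,k'}:L(H_2)\to L(H_2)$ is $\mathcal{L}_{k,k'}B=\sum_n U_kA_nBA_n^*U_{k'}^*$. In $\det(1-z\mathcal{L}_{k,k+\nu})$, $1$ is the identity operator of $L(H_2)$. The characteristic function is $\hat P(\nu,t)=\sum_{x\in\mathbb{Z}}e^{i\nu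 x}p(x,t)$; equivalently $\hat P(\nu,t)=\frac{1}{2\pi}\int_0^{2\pi}\mathrm{Tr}\{\mathcal{L}_{k,k+\nu}^t|\Phi_0\rangle\langle\Phi_0|\}\,dk$. Multiplicity of an eigenvalue means algebraic multiplicity. *)

(* Defs.v *)
From mathcomp Require Import all_boot all_order all_algebra.
From mathcomp Require Import spectral sesquilinear complex.
From mathcomp Require Import all_classical all_reals all_analysis.
Import Order.TTheory GRing.Theory Num.Theory.
Import numFieldNormedType.Exports.

Set Implicit Arguments.
Unset Strict Implicit.
Unset Printing Implicit Defensive.

Local Open Scope classical_set_scope.
Local Open Scope ring_scope.
Local Open Scope complex_scope.
Local Open Scope sesquilinear_scope.

Definition cexp (R : realType) (z : R[i]) : R[i] :=
  (expR (complex.Re z) * cos (complex.Im z)) +i* (expR (complex.Re z) * sin (complex.Im z)).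

Definition cintegrable (R : realType) (a b : R) (f : R -> R[i]) : Prop :=
  lebesgue_measure.-integrable `[a, b] (fun x => (complex.Re (f x))%:E) /\
  lebesgue_measure.-integrable `[a, b] (fun x => (complex.Im (f x))%:E).

Definition cintegral (R : realType) (a b : R) (f : R -> R[i]) : R[i] :=
  (\int[lebesgue_measure]_(x in `[a, b]) complex.Re (f x)) +i*
  (\int[lebesgue_measure]_(x in `[a, b]) complex.Im (f x)).

(* Derivatives of z : R -> R[i] with respect to its real argument are taken
   componentwise. *)
Definition twice_derivable (R : realType) (f : R -> R) (x : R) : Prop :=
  (\forall y \near x, derivable f y 1) /\ derivable (derive1 f) x 1.

Definition ctwice_derivable (R : realType) (z : R -> R[i]) (x : R) : Prop :=
  twice_derivable (fun y => complex.Re (z y)) x /\ twice_derivable (fun y => complex.Im (z y)) x.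

Definition cderive2 (R : realType) (z : R -> R[i]) (x : R) : R[i] :=
  (derive1n 2 (fun y => complex.Re (z y)) x) +i* (derive1n 2 (fun y => complex.Im (z y)) x).

(* The coin space has ordered basis |R> = index 0, |L> = index 1. *)
Definition PR (R : realType) : 'M[R[i]]_2 := delta_mx 0 0.
Definition PL (R : realType) : 'M[R[i]]_2 := delta_mx 1 1.

(* An operator K on H_p (x) H_2 is represented by its 2 x 2 blocks
   K x y = <x|K|y>.  Every operator occurring below has finitely many nonzero
   blocks in each row and column, and the states rho_t have finitely many
   nonzero blocks altogether, so that the sums over int are finite. *)
Definition kernel_op (R : realType) : Type := int -> int -> 'M[R[i]]_2.

Definition kmul (R : realType) (K L : kernel_op R) : kernel_op R :=
  fun x y => \sum_(z \in [set: int]) (K x z *m L z y).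

Definition kadd (R : realType) (K L : kernel_op R) : kernel_op R :=
  fun x y => K x y + L x y.

Definition kadj (R : realType) (K : kernel_op R) : kernel_op R :=
  fun x y => (K y x)^t*.

Definition ktrace (R : realType) (K : kernel_op R) : R[i] :=
  \sum_(x \in [set: int]) \tr (K x x).

Definition tensor (R : realType) (S : int -> int -> R[i]) (B : 'M[R[i]]_2) :
  kernel_op R := fun x y => S x y *: B.

Definition pos_id (R : realType) (x y : int) : R[i] := (x == y)%:R.
Definition pos_shiftp (R : realType) (x y : int) : R[i] := (x == y + 1)%:R.
Definition pos_shiftm (R : realType) (x y : int) : R[i] := (x == y - 1)%:R.
(* |a><a| *)
Definition pos_proj (R : realType) (a x y : int) : R[i] :=
  ((x == a) && (y == a))%:R.

Definition walkE (R : realType) (U : 'M[R[i]]_2) : kernel_op R :=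
  kmul (kadd (tensor (@pos_shiftp R) (PR R)) (tensor (@pos_shiftm R) (PL R)))
       (tensor (@pos_id R) U).

Definition walk_step (R : realType) (U : 'M[R[i]]_2) (m : nat)
    (A : 'I_m -> 'M[R[i]]_2) (rho : kernel_op R) : kernel_op R :=
  fun x y => \sum_(n < m)
    kmul (kmul (kmul (kmul (walkE U) (tensor (@pos_id R) (A n))) rho)
               (kadj (tensor (@pos_id R) (A n))))
         (kadj (walkE U)) x y.

Definition walk_state (R : realType) (U : 'M[R[i]]_2) (m : nat)
    (A : 'I_m -> 'M[R[i]]_2) (Phi0 : 'cV[R[i]]_2) (t : nat) : kernel_op R :=
  iter t (walk_step U A) (tensor (pos_proj R 0) (Phi0 *m Phi0^t*)).

Definition position_prob (R : realType) (U : 'M[R[i]]_2) (m : nat)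
    (A : 'I_m -> 'M[R[i]]_2) (Phi0 : 'cV[R[i]]_2) (x : int) (t : nat) : R[i] :=
  ktrace (kmul (tensor (pos_proj R x) 1%:M) (walk_state U A Phi0 t)).

Definition char_fun (R : realType) (U : 'M[R[i]]_2) (m : nat)
    (A : 'I_m -> 'M[R[i]]_2) (Phi0 : 'cV[R[i]]_2) (nu : R) (t : nat) : R[i] :=
  \sum_(x \in [set: int])
    (cexp (0 +i* (nu * x%:~R)) * position_prob U A Phi0 x t).

Definition unital_measurement (R : realType) (m : nat)
    (A : 'I_m -> 'M[R[i]]_2) : Prop :=
  \sum_(n < m) (A n)^t* *m A n = 1%:M /\ \sum_(n < m) A n *m (A n)^t* = 1%:M.

Definition Uk (R : realType) (U : 'M[R[i]]_2) (k : R) : 'M[R[i]]_2 :=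
  (cexp (0 +i* (- k)) *: PR R + cexp (0 +i* k) *: PL R) *m U.

Definition superop (R : realType) (U : 'M[R[i]]_2) (m : nat)
    (A : 'I_m -> 'M[R[i]]_2) (k k' : R) (B : 'M[R[i]]_2) : 'M[R[i]]_2 :=
  \sum_(n < m) Uk U k *m A n *m B *m (A n)^t* *m (Uk U k')^t*.

(* The matrix of L_{k,k'} in the basis of elementary matrices of L(H_2).  It
   acts on row vectors (mxvec B *m superop_mx = mxvec (L_{k,k'} B)), which does
   not affect determinants or eigenvalues. *)
Definition superop_mx (R : realType) (U : 'M[R[i]]_2) (m : nat)
    (A : 'I_m -> 'M[R[i]]_2) (k k' : R) : 'M[R[i]]_(2 * 2) :=
  lin_mx (superop U A k k').

Definition alg_multiplicity (F : fieldType) (n : nat) (a : F) (M : 'M[F]_n) :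
  nat := mup a (char_poly M).

(* The regular module R[i]^o carries the topology of the complex norm. *)
Definition principal_root (R : realType) (U : 'M[R[i]]_2) (m : nat)
    (A : 'I_m -> 'M[R[i]]_2) (k : R) (z : R -> R[i]) : Prop :=
  [/\ z 0 = 1,
      \forall nu \near (0 : R),
        \det (1%:M - z nu *: superop_mx U A k (k + nu)) = 0
    & \forall nu \near (0 : R), {for nu, continuous (z : R -> R[i]^o)}].

(* Main.v *)
(* Right multiplication by diag(e^{i nu}, e^{-i nu}) turns L_{k,k} into L_{k,k+nu},
   so the characteristic polynomial of e^{i nu} L_{k,k+nu} has coefficients that
   are polynomials in e^{i nu}.  As 1 is a simple root at nu = 0, divided
   differences give a unique nearby root for small nu, twice differentiable at 0;
   this yields z_0, together with an eigenvector u(nu) of the dual of L_{k,k+nu}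
   for the eigenvalue 1/z_0(nu), tending to the trace functional.  Unitality makes
   L_{k,k+nu} a contraction for the Hilbert-Schmidt norm and forces z_0'(0) = 0.
   Hence Tr(L_{k,k+nu}^t rho) = z_0(nu)^(-t) <rho, u(nu)> + o(1) as nu -> 0,
   uniformly in t, and z_0(nu / sqrt t)^(-t) tends to exp(- z_0''(0) nu^2 / 2).
   The contraction property also bounds the integrand of the Fourier
   representation of the characteristic function, and dominated convergence
   concludes. *)

(* The branch [z0] is arbitrary: any continuous root, given separately for each [k]. Regularity is
   therefore derived for every such branch and kept apart from existence. Nothing is known about
   [z0] as a function of [k], so the limit integrand gets its measurability from being a pointwise
   limit of trigonometric polynomials in [k]. Unitality enters z_0'(0) = 0 as follows. The identity
   is fixed by L_{k,k}, so L_{k,k+nu} sends it to diag(e^{i nu}, e^{-i nu}). Pairing with u = u(nu)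
   gives e^{i nu} u_00 + e^{-i nu} u_11 = (u_00 + u_11) / z_0(nu). As u tends to the trace, both
   diagonal entries tend to 1, and the first order reads i - i = -2 z_0'(0). With the linear term
   gone, the scale nu / sqrt t is the one at which t (1/z_0 - 1) has a finite limit, namely
   -z_0''(0) nu^2 / 2. Passing from there to the t-th power needs bases in the unit disc; this is
   the contraction property again, since 1/z_0 is an eigenvalue of L_{k,k+nu}. *)
Require Import Defs.
From HB Require Import structures.
From mathcomp Require Import all_boot all_order all_algebra.
From mathcomp Require Import spectral sesquilinear complex.
From mathcomp Require Import all_classical all_reals all_analysis.
From mathcomp Require Import polyXY measurable_realfun ring lra.
Import Order.TTheory GRing.Theory Num.Theory.
Import numFieldNormedType.Exports.
Import Normc.

Set Implicit Arguments.
Unset Strict Implicit.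
Unset Printing Implicit Defensive.

Local Open Scope classical_set_scope.
Local Open Scope ring_scope.
Local Open Scope complex_scope.
Local Open Scope sesquilinear_scope.

(** * Limits of complex-valued functions *)

Section ComplexLimits.
Variable R : realType.
Local Notation C := R[i].
Local Notation Re := (@complex.Re R).
Local Notation Im := (@complex.Im R).
Implicit Types (z w : C).

Lemma cReD z w : Re (z + w) = Re z + Re w. Proof. by case: z; case: w. Qed.
Lemma cImD z w : Im (z + w) = Im z + Im w. Proof. by case: z; case: w. Qed.
Lemma cReN z : Re (- z) = - Re z. Proof. by case: z. Qed.
Lemma cImN z : Im (- z) = - Im z. Proof. by case: z. Qed.
Lemma cReM z w : Re (z * w) = Re z * Re w - Im z * Im w.
Proof. by case: z; case: w. Qed.
Lemma cImM z w : Im (z * w) = Re z * Im w + Im z * Re w.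
Proof. by case: z; case: w. Qed.
Lemma cReV z : Re z^-1 = Re z / (Re z ^+ 2 + Im z ^+ 2).
Proof. by case: z. Qed.
Lemma cImV z : Im z^-1 = - (Im z / (Re z ^+ 2 + Im z ^+ 2)).
Proof. by case: z. Qed.
Definition ReImE := (cReD, cImD, cReN, cImN, cReM, cImM).

Lemma complex_ext z w : Re z = Re w -> Im z = Im w -> z = w.
Proof. by case: z => a b; case: w => c d /= -> ->. Qed.

Lemma normc_sqrt z : normc z = Num.sqrt (Re z ^+ 2 + Im z ^+ 2).
Proof. by case: z. Qed.

Lemma normc_ge0 z : 0 <= normc z.
Proof. by rewrite normc_sqrt sqrtr_ge0. Qed.

Lemma normc_le z (r : R) : (`|z| <= r%:C) = (normc z <= r).
Proof. by rewrite normc_def -normc_sqrt lecR. Qed.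

Lemma ler_normcD z w : normc (z + w) <= normc z + normc w.
Proof. by rewrite -lecR rmorphD; exact: (@ler_normD _ C). Qed.

Lemma normcB z w : normc (z - w) = normc (w - z).
Proof. by rewrite -opprB normcN. Qed.

Lemma normc_eq0 z : (normc z == 0) = (z == 0).
Proof.
by apply/eqP/eqP => [/eq0_normc//|->]; exact: normc0.
Qed.

Lemma normc_gt0 z : (0 < normc z) = (z != 0).
Proof. by rewrite lt_def normc_ge0 andbT normc_eq0. Qed.

Lemma normcX z n : normc (z ^+ n) = normc z ^+ n.
Proof. by elim: n => [|n IH]; [exact: normc1|rewrite !exprS normcM IH]. Qed.

Lemma normc_real (r : R) : normc r%:C = `|r|.
Proof. by rewrite normc_sqrt /= expr0n addr0 sqrtr_sqr. Qed.

Lemma normc_sum (I : Type) (r : seq I) (P : pred I) (F : I -> C) :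
  normc (\sum_(i <- r | P i) F i) <= \sum_(i <- r | P i) normc (F i).
Proof.
elim/big_rec2: _ => [|i y x _ le]; first by rewrite (normc0 R).
by apply: (le_trans (ler_normcD _ _)); rewrite lerD2l.
Qed.

Lemma Re_le_normc z : `|Re z| <= normc z.
Proof. by rewrite normc_sqrt -sqrtr_sqr ler_wsqrtr// lerDl sqr_ge0. Qed.

Lemma Im_le_normc z : `|Im z| <= normc z.
Proof. by rewrite normc_sqrt -sqrtr_sqr ler_wsqrtr// lerDr sqr_ge0. Qed.

Lemma normc_le_ReIm z : normc z <= `|Re z| + `|Im z|.
Proof.
have {1}-> : z = (Re z)%:C + (Im z)%:C * 'i.
  by apply: complex_ext; rewrite !ReImE /=; ring.
apply: le_trans (ler_normcD _ _) _; rewrite normcM !normc_real /=.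
by rewrite expr0n/= add0r expr1n sqrtr1 mulr1.
Qed.

(* Limits are taken componentwise, so that they reduce to limits in [R]. *)
Definition ccvg (T : Type) (F : set_system T) (f : T -> C) (l : C) :=
  (Re (f x) @[x --> F] --> Re l) /\ (Im (f x) @[x --> F] --> Im l).

Section Filter.
Context (T : Type) (F : set_system T) {FF : Filter F}.
Implicit Types (f g : T -> C) (l m : C).

Lemma ccvg_normcP f l : ccvg F f l <->
  forall e : R, 0 < e -> \forall x \near F, normc (f x - l) <= e.
Proof.
split=> [[/cvgrPdist_le fr /cvgrPdist_le fi] e e0|H].
  have e2 : 0 < e / 2 by rewrite divr_gt0.
  near=> x; apply: le_trans (normc_le_ReIm _) _.
  rewrite !ReImE distrC [X in _ + X]distrC [e]splitr; apply: lerD.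
    by near: x; exact: fr.
  by near: x; exact: fi.
split; apply/cvgrPdist_le => e e0; near=> x.
  rewrite distrC -cReN -cReD; apply: le_trans (Re_le_normc _) _.
  by near: x; exact: H.
rewrite distrC -cImN -cImD; apply: le_trans (Im_le_normc _) _.
by near: x; exact: H.
Unshelve. all: by end_near. Qed.

Lemma ccvgE f l : ccvg F f l <-> (f : T -> C^o) @ F --> (l : C^o).
Proof.
rewrite ccvg_normcP; split=> [H|/cvgrPdist_le H e e0].
  apply/cvgrPdist_le => e; rewrite ltcE/= => /andP[/eqP ei er].
  have -> : e = (Re e)%:C by case: e {er} ei => /= a b ->.
  near=> x; by rewrite distrC normc_le; near: x; exact: H.
near=> x; rewrite -normc_le distrC; near: x.
by apply: H; rewrite ltcR.
Unshelve. all: by end_near. Qed.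

Lemma near_eq_ccvg f g l : (\forall x \near F, f x = g x) ->
  ccvg F f l -> ccvg F g l.
Proof.
move=> fg [fr fi]; split.
  by apply: cvg_trans fr; apply: near_eq_cvg; near=> x; congr Re; near: x.
by apply: cvg_trans fi; apply: near_eq_cvg; near=> x; congr Im; near: x.
Unshelve. all: by end_near. Qed.

Lemma ccvg_cst l : ccvg F (fun=> l) l.
Proof. by split; exact: cvg_cst. Qed.

Lemma ccvgD f g l m : ccvg F f l -> ccvg F g m ->
  ccvg F (fun x => f x + g x) (l + m).
Proof.
move=> [fr fi] [gr gi]; split; rewrite !ReImE.
  by under eq_fun do rewrite cReD; exact: cvgD.
by under eq_fun do rewrite cImD; exact: cvgD.
Qed.

Lemma ccvgN f l : ccvg F f l -> ccvg F (fun x => - f x) (- l).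
Proof.
move=> [fr fi]; split; rewrite !ReImE.
  by under eq_fun do rewrite cReN; exact: cvgN.
by under eq_fun do rewrite cImN; exact: cvgN.
Qed.

Lemma ccvgB f g l m : ccvg F f l -> ccvg F g m ->
  ccvg F (fun x => f x - g x) (l - m).
Proof. by move=> fl /ccvgN; exact: ccvgD. Qed.

Lemma ccvgM f g l m : ccvg F f l -> ccvg F g m ->
  ccvg F (fun x => f x * g x) (l * m).
Proof.
move=> [fr fi] [gr gi]; split; rewrite !ReImE.
  by under eq_fun do rewrite cReM; apply: cvgB; exact: cvgM.
by under eq_fun do rewrite cImM; apply: cvgD; exact: cvgM.
Qed.

Lemma ccvgX f l n : ccvg F f l -> ccvg F (fun x => f x ^+ n) (l ^+ n).
Proof.
move=> fl; elim: n => [|n IH]; first exact: ccvg_cst.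
by rewrite exprS; under eq_fun do rewrite exprS; exact: ccvgM.
Qed.

Lemma ccvg_sum (I : Type) (r : seq I) (P : pred I) (f : I -> T -> C) (l : I -> C) :
  (forall i, P i -> ccvg F (f i) (l i)) ->
  ccvg F (fun x => \sum_(i <- r | P i) f i x) (\sum_(i <- r | P i) l i).
Proof.
move=> H; elim: r => [|i r IH].
  by rewrite big_nil; under eq_fun do rewrite big_nil; exact: ccvg_cst.
rewrite big_cons; under eq_fun do rewrite big_cons.
by case: ifPn => // Pi; apply: ccvgD => //; exact: H.
Qed.

Lemma ccvgV f l : l != 0 -> ccvg F f l -> ccvg F (fun x => (f x)^-1) l^-1.
Proof.
move=> l0 [fr fi].
have n0 : Re l ^+ 2 + Im l ^+ 2 != 0.
  apply: contra l0; rewrite paddr_eq0 ?sqr_ge0// !sqrf_eq0 => /andP[/eqP a /eqP b].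
  by apply/eqP/complex_ext.
have h : (Re (f x) ^+ 2 + Im (f x) ^+ 2)^-1 @[x --> F] -->
    (Re l ^+ 2 + Im l ^+ 2)^-1.
  by apply: cvgV => //; apply: cvgD; apply: cvgM.
split; rewrite ?cReV ?cImV.
  by under eq_fun do rewrite cReV; exact: cvgM.
by under eq_fun do rewrite cImV; apply: cvgN; exact: cvgM.
Qed.

Lemma ccvg_normc f l : ccvg F f l -> normc (f x) @[x --> F] --> normc l.
Proof.
move=> [fr fi]; rewrite normc_sqrt; under eq_fun do rewrite normc_sqrt.
apply: continuous_cvg; first exact: sqrt_continuous.
by apply: cvgD; apply: cvgM.
Qed.

Lemma ccvg_squeeze f l (g : T -> R) : g @ F --> 0 ->
  (\forall x \near F, normc (f x - l) <= g x) -> ccvg F f l.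
Proof.
move=> /cvgrPdist_le g0 fg; apply/ccvg_normcP => e e0; near=> x.
apply: (@le_trans _ _ (g x)); first by near: x.
by apply: le_trans (ler_norm _) _; rewrite -normrN -[- _]sub0r; near: x; exact: g0.
Unshelve. all: by end_near. Qed.

End Filter.

Lemma ccvg_comp (S T : Type) (F : set_system S) (G : set_system T)
    (h : S -> T) f l : h @ F --> G -> ccvg G f l -> ccvg F (f \o h) l.
Proof. move=> hF [fr fi]; split.
  exact: (@cvg_comp _ _ _ h (fun y => Re (f y)) _ _ _ hF fr).
exact: (@cvg_comp _ _ _ h (fun y => Im (f y)) _ _ _ hF fi). Qed.

Lemma ccvg_unique (T : Type) (F : set_system T) {FF : ProperFilter F}
    (f : T -> C) l m : ccvg F f l -> ccvg F f m -> l = m.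
Proof.
move=> [fr fi] [gr gi]; apply: complex_ext.
  exact: (cvg_unique _ fr gr).
exact: (cvg_unique _ fi gi).
Qed.

End ComplexLimits.

(** * Differentiability of complex functions of a real variable *)

Section ComplexDerivatives.
Variable R : realType.
Local Notation C := R[i].
Local Notation Re := (@complex.Re R).
Local Notation Im := (@complex.Im R).
Implicit Types (f g : R -> C) (x : R) (d : C).

Lemma ccvg_neq0 (T : Type) (F : set_system T) {FF : Filter F} (f : T -> C) l :
  ccvg F f l -> l != 0 -> \forall x \near F, f x != 0.
Proof.
move=> /ccvg_normcP fl l0; have n0 : 0 < normc l by rewrite normc_gt0.
have n2 : 0 < normc l / 2 by rewrite divr_gt0.
near=> x; apply/eqP => fx0.
have : normc (f x - l) <= normc l / 2 by near: x; exact: fl.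
rewrite fx0 sub0r normcN; lra.
Unshelve. all: by end_near. Qed.

Lemma cvg_dnbhs_addr (x : R) : h + x @[h --> 0^'] --> x.
Proof.
apply: (@cvg_trans _ (h + x @[h --> (0 : R)])).
  by move=> B; apply: (@cvg_within _ (nbhs (0 : R))).
have : (h + x) @[h --> (0 : R)] --> 0 + x.
  by apply: cvgD; [exact: cvg_id|exact: cvg_cst].
by rewrite add0r.
Qed.

(* Caratheodory's form of differentiability: the slope extends continuously. *)
Definition cdiff f x d := exists2 g : R -> C, ccvg (nbhs x) g d &
  \forall y \near x, f y = f x + g y * (y - x)%:C.

(** [ctwice_derivable] and [cderive2] speak of components, whereas the slope form lets products,
    inverses and implicit functions be treated by algebra. *)
Lemma cdiffP f x d : cdiff f x d <->
  is_derive x 1 (fun y => Re (f y)) (Re d) /\ is_derive x 1 (fun y => Im (f y)) (Im d).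
Proof.
split=> [[g [gr gi] fE]|].
  (* [p] stands for [Re] or [Im]; real linearity is all that the argument uses of them. *)
  have slope (p : C -> R) (pf : forall u v (r : R), p (u + v * r%:C) = p u + p v * r) :
      p (g y) @[y --> x] --> p d ->
      is_derive x 1 (fun y => p (f y)) (p d).
    move=> pg.
    have shx : h + x @[h --> 0^'] --> x.
      exact: cvg_dnbhs_addr.
    have H : h^-1 *: (((fun y => p (f y)) \o shift x) (h *: 1) - p (f x)) @[h --> 0^']
        --> p d.
      have H0 : p (g (h + x)) @[h --> 0^'] --> p d.
        exact: (@cvg_comp _ _ _ (fun h => h + x) (fun y => p (g y)) _ _ _ shx pg).
      apply: cvg_trans H0; apply: near_eq_cvg; near=> h.
      have h0 : h != 0 by near: h; exact: nbhs_dnbhs_neq.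
      rewrite /= [h *: 1]mulr1.
      have -> : f (h + x) = f x + g (h + x) * (h + x - x)%:C.
        by near: h; exact: (shx _ fE).
      by rewrite pf addrK addrAC subrr add0r /GRing.scale /= mulrC mulfK.
    split; first by apply/cvg_ex; exists (p d).
    exact: cvg_lim.
  split; apply: slope => // u v r; rewrite !ReImE /=; ring.
rewrite !is_derive1_caratheodory => -[[gr [frE cr grx]] [gi [fiE ci gix]]].
exists (fun y => gr y +i* gi y).
  by split => /=; rewrite -?grx -?gix.
near=> y; apply: complex_ext; rewrite !ReImE /=.
  by have := frE y; lra.
by have := fiE y; lra.
Unshelve. all: by end_near. Qed.

Lemma cdiff_cvg f x d : cdiff f x d -> ccvg (nbhs x) f (f x).
Proof.
move=> [g gd fE]; apply: (near_eq_ccvg (f := fun y => f x + g y * (y - x)%:C)).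
  by near=> y; apply/esym; near: y.
have -> : f x = f x + d * 0 by rewrite mulr0 addr0.
rewrite {1}mulr0 addr0.
apply: ccvgD; first exact: ccvg_cst.
apply: ccvgM => //; split => /=; last exact: cvg_cst.
by rewrite -(subrr x); apply: cvgB; [exact: cvg_id|exact: cvg_cst].
Unshelve. all: by end_near. Qed.

Lemma near_eq_cdiff f g x d : (\forall y \near x, f y = g y) ->
  cdiff f x d -> cdiff g x d.
Proof.
move=> fg [h hd fE]; exists h => //; near=> y.
rewrite -(nbhs_singleton fg).
have <- : f y = g y by near: y.
by near: y.
Unshelve. all: by end_near. Qed.

Lemma cdiff_cst (c : C) x : cdiff (fun=> c) x 0.
Proof.
exists (fun=> 0); first exact: ccvg_cst.
by near=> y; rewrite mul0r addr0.
Unshelve. all: by end_near. Qed.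

Lemma cdiffD f g x d d' : cdiff f x d -> cdiff g x d' ->
  cdiff (fun y => f y + g y) x (d + d').
Proof.
move=> [f1 fd fE] [g1 gd gE]; exists (fun y => f1 y + g1 y); first exact: ccvgD.
near=> y.
have -> : f y = f x + f1 y * (y - x)%:C by near: y.
have -> : g y = g x + g1 y * (y - x)%:C by near: y.
ring.
Unshelve. all: by end_near. Qed.

Lemma cdiffM f g x d d' : cdiff f x d -> cdiff g x d' ->
  cdiff (fun y => f y * g y) x (d * g x + f x * d').
Proof.
move=> df dg; have gc := cdiff_cvg dg.
move: df dg => [f1 fd fE] [g1 gd gE].
exists (fun y => f1 y * g y + f x * g1 y).
  by apply: ccvgD; apply: ccvgM => //; exact: ccvg_cst.
near=> y.
have -> : f y = f x + f1 y * (y - x)%:C by near: y.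
have -> : g y = g x + g1 y * (y - x)%:C by near: y.
ring.
Unshelve. all: by end_near. Qed.

Lemma cdiffN f x d : cdiff f x d -> cdiff (fun y => - f y) x (- d).
Proof.
move=> [f1 fd fE]; exists (fun y => - f1 y); first exact: ccvgN.
near=> y.
have -> : f y = f x + f1 y * (y - x)%:C by near: y.
ring.
Unshelve. all: by end_near. Qed.

Lemma cdiffV f x d : f x != 0 -> cdiff f x d ->
  cdiff (fun y => (f y)^-1) x (- d / f x ^+ 2).
Proof.
move=> f0 df; have fc := cdiff_cvg df; have fn0 : \forall y \near x, f y != 0.
  exact: ccvg_neq0 fc f0.
move: df => [f1 fd fE]; exists (fun y => - f1 y / (f y * f x)).
  rewrite expr2; apply: ccvgM; first exact: ccvgN.
  apply: ccvgV; first by rewrite mulf_neq0.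
  by apply: ccvgM => //; exact: ccvg_cst.
near=> y.
have fy0 : f y != 0 by near: y.
have e : f y = f x + f1 y * (y - x)%:C by near: y.
apply: (mulfI fy0); rewrite mulfV// mulrDr mulrA.
have -> : f y * (- f1 y / (f y * f x)) = - f1 y / f x by field; rewrite f0.
rewrite {1}e; field.
by rewrite f0.
Unshelve. all: by end_near. Qed.

Definition cexpi (x : R) : C := cexp (0 +i* x).

Lemma cexpiE x : cexpi x = cos x +i* sin x.
Proof. by rewrite /cexpi /cexp /= expR0 !mul1r. Qed.

Lemma cdiff_cexpi x : cdiff cexpi x ('i * cexpi x).
Proof.
have e y : cexpi y = cos y +i* sin y by exact: cexpiE.
apply/cdiffP; split; under eq_fun do rewrite e; rewrite !ReImE e /=.
  by apply: is_derive_eq; ring.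
by apply: is_derive_eq; ring.
Qed.

(** The derivative near [x] is carried as an explicit function, so that the product and inverse
    rules can be applied to it a second time. *)
Definition c2diff f x :=
  exists2 d : R -> C, (\forall y \near x, cdiff f y (d y)) & exists d', cdiff d x d'.

Lemma c2diffM f g x : c2diff f x -> c2diff g x -> c2diff (fun y => f y * g y) x.
Proof.
move=> [df fd [ddf dfd]] [dg gd [ddg dgd]].
exists (fun y => df y * g y + f y * dg y).
  by near=> y; apply: cdiffM; near: y.
have := nbhs_singleton fd; have := nbhs_singleton gd => gx fx.
by eexists; apply: cdiffD; apply: cdiffM; eassumption.
Unshelve. all: by end_near. Qed.

Lemma c2diffV f x : f x != 0 -> c2diff f x -> c2diff (fun y => (f y)^-1) x.
Proof.
move=> f0 [df fd [ddf dfd]]; have fx := nbhs_singleton fd.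
have fn0 : \forall y \near x, f y != 0.
  exact: ccvg_neq0 (cdiff_cvg fx) f0.
exists (fun y => - df y / f y ^+ 2).
  by near=> y; apply: cdiffV; near: y.
eexists; apply: cdiffM; first by apply: cdiffN; eassumption.
apply: cdiffV; first by rewrite expf_neq0.
by under eq_fun do rewrite expr2; apply: cdiffM; eassumption.
Unshelve. all: by end_near. Qed.

Lemma near_eq_c2diff f g x : (\forall y \near x, f y = g y) ->
  c2diff f x -> c2diff g x.
Proof.
move=> fg [df fd dfd]; exists df => //.
have fgj := near_join fg; near=> y.
have e : \forall z \near y, f z = g z by near: y.
have h : cdiff f y (df y) by near: y.
exact: near_eq_cdiff e h.
Unshelve. all: by end_near. Qed.

Lemma c2diff_ctwice_derivable f x : c2diff f x -> ctwice_derivable f x.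
Proof.
move=> [df fd [d' dfd]].
suff tw (p : C -> R) : (forall h y d, cdiff h y d -> is_derive y 1 (fun y => p (h y)) (p d)) ->
    twice_derivable (fun y => p (f y)) x.
  by split; apply: tw => h y d /cdiffP[].
move=> pd; split.
  near=> y; have h : cdiff f y (df y) by near: y.
  by have [] := pd _ _ _ h.
have e : \forall y \near x, p (df y) = derive1 (fun y => p (f y)) y.
  near=> y; rewrite derive1E; apply/esym.
  have h : cdiff f y (df y) by near: y.
  by have [] := pd _ _ _ h.
have [dd _] := pd df x d' dfd.
exact: near_eq_derivable e dd.
Unshelve. all: by end_near. Qed.

End ComplexDerivatives.

(** * Divided differences of polynomials *)

Section DividedDifference.
Variable A : comNzRingType.
Implicit Types (p : {poly A}) (x y : A).

(** The quotient (p(x) - p(y)) / (x - y) written without division: it makes sense on the diagonal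
    and over any commutative ring, in particular over polynomials. *)
Definition divided_diff p x y :=
  \sum_(j < size p) p`_j * \sum_(i < j) x ^+ (j.-1 - i) * y ^+ i.

Lemma divided_diffE p x y : p.[x] - p.[y] = (x - y) * divided_diff p x y.
Proof.
rewrite !horner_coef -sumrB mulr_sumr; apply: eq_bigr => j _.
by rewrite -mulrBr subrXX mulrCA.
Qed.

Lemma divided_diff_deriv p x : divided_diff p x x = p^`().[x].
Proof.
have sd : (size p^`() <= (size p).-1)%N.
  have [->|p0] := eqVneq p 0; first by rewrite deriv0 size_poly0.
  by rewrite -ltnS prednK ?lt_size_deriv// lt0n size_poly_eq0.
rewrite [in RHS](horner_coef_wide _ sd).
rewrite /divided_diff; case: (size p) => [|n].
  by rewrite !big_ord0.
rewrite big_ord_recl big_ord0 mulr0 add0r /=.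
apply: eq_bigr => j _; rewrite coef_deriv /= /bump /= add1n -mulr_natr -mulrA.
congr (_ * _); rewrite (eq_bigr (fun=> x ^+ j)) => [|i _].
  by rewrite sumr_const card_ord mulr_natl.
by rewrite -exprD subnK// -ltnS.
Qed.

End DividedDifference.

(** * Implicit functions defined by a bivariate polynomial P(y, s), with y the outer variable *)

Section ImplicitPolynomial.
Variable R : realType.
Local Notation C := R[i].
Implicit Types (P : {poly {poly C}}) (p : {poly C}).

Lemma horner_eval_map P (y s : C) : (map_poly (horner_eval s) P).[y] = P.[y%:P].[s].
Proof.
by rewrite -{1}[y](hornerC y s); exact: (horner_map (horner_eval s) P y%:P).
Qed.

(** Change y at fixed s, then s at fixed y1. This exact identity replaces the mean value theorem in
    the implicit function arguments. *)
Lemma ev_sub P (y y1 s s1 : C) : P.[y%:P].[s] - P.[y1%:P].[s1] =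
  (y - y1) * (divided_diff P y%:P y1%:P).[s] + (s - s1) * divided_diff P.[y1%:P] s s1.
Proof.
rewrite -divided_diffE.
have -> : (y - y1) * (divided_diff P y%:P y1%:P).[s] =
    ((y%:P - y1%:P) * divided_diff P y%:P y1%:P).[s].
  by rewrite hornerM hornerD hornerN !hornerC.
by rewrite -divided_diffE hornerD hornerN; ring.
Qed.

Section Filter.
Context (T : Type) (F : set_system T) {FF : Filter F}.

Lemma ccvg_horner p (f : T -> C) l : ccvg F f l -> ccvg F (fun x => p.[f x]) p.[l].
Proof.
move=> fl; rewrite horner_coef; under eq_fun do rewrite horner_coef.
apply: ccvg_sum => i _; apply: ccvgM; first exact: ccvg_cst.
exact: ccvgX.
Qed.

Lemma ccvg_divided_diff p (f g : T -> C) l m : ccvg F f l -> ccvg F g m ->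
  ccvg F (fun x => divided_diff p (f x) (g x)) (divided_diff p l m).
Proof.
move=> fl gm; apply: ccvg_sum => i _; apply: ccvgM; first exact: ccvg_cst.
by apply: ccvg_sum => j _; apply: ccvgM; exact: ccvgX.
Qed.

Lemma horner_divided_diff P (y z s : C) : (divided_diff P y%:P z%:P).[s] =
  \sum_(j < size P) (P`_j).[s] * \sum_(i < j) y ^+ (j.-1 - i) * z ^+ i.
Proof.
rewrite horner_sum; apply: eq_bigr => j _; rewrite hornerM horner_sum.
by congr (_ * _); apply: eq_bigr => i _; rewrite -!rmorphXn hornerM !hornerC.
Qed.

Lemma ccvg_horner_divided_diff P (f g s : T -> C) l m n :
  ccvg F f l -> ccvg F g m -> ccvg F s n ->
  ccvg F (fun x => (divided_diff P (f x)%:P (g x)%:P).[s x])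
         (divided_diff P l%:P m%:P).[n].
Proof.
move=> fl gm sn; rewrite horner_divided_diff.
under eq_fun do rewrite horner_divided_diff.
apply: ccvg_sum => i _; apply: ccvgM; first exact: ccvg_horner.
by apply: ccvg_sum => j _; apply: ccvgM; exact: ccvgX.
Qed.

End Filter.

Lemma cdiff_horner p (s : R -> C) x d : cdiff s x d ->
  exists d', cdiff (fun nu => p.[s nu]) x d'.
Proof.
move=> sd; elim/poly_ind: p => [|p c [d' pd]].
  by exists 0; under eq_fun do rewrite horner0; exact: cdiff_cst.
by eexists; under eq_fun do rewrite hornerMXaddC;
  apply: cdiffD (cdiff_cst _ _); apply: cdiffM; eassumption.
Qed.

Lemma cdiff_horner2 P (y s : R -> C) x d e : cdiff y x d -> cdiff s x e ->
  exists d', cdiff (fun nu => P.[(y nu)%:P].[s nu]) x d'.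
Proof.
move=> yd sd; elim/poly_ind: P => [|P c [d' pd]].
  by exists 0; under eq_fun do rewrite !horner0; exact: cdiff_cst.
have [d2 cd] := cdiff_horner c sd.
by eexists; under eq_fun do rewrite hornerMXaddC hornerD hornerM hornerC;
  apply: cdiffD; [apply: cdiffM|]; eassumption.
Qed.

(** Puts the partial derivative in the inner variable into the form of a fixed bivariate polynomial
    evaluated at y, to which [cdiff_horner2] applies. *)
Lemma deriv_horner_polyC P (y : C) :
  P.[y%:P]^`() = (swapXY (swapXY P)^`()).[y%:P].
Proof. by rewrite !horner_polyC swapXYK deriv_map. Qed.

(** Both values of P vanish, so [ev_sub] reads (y - y(x)) A + (s - s(x)) B = 0, where A tends to the
    nonzero partial derivative in y. Solving for y - y(x) exhibits the slope; continuity of [y] at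
    [x] is enough. *)
Lemma implicit_cdiff P (y s : R -> C) x e :
  cdiff s x e -> ccvg (nbhs x) y (y x) ->
  (\forall nu \near x, P.[(y nu)%:P].[s nu] = 0) ->
  P^`().[(y x)%:P].[s x] != 0 ->
  cdiff y x (- (P.[(y x)%:P]^`().[s x] * e) / P^`().[(y x)%:P].[s x]).
Proof.
move=> sd yc P0 Py; have sc := cdiff_cvg sd.
case: sd => g ge sE.
pose A nu := (divided_diff P (y nu)%:P (y x)%:P).[s nu].
pose B nu := divided_diff P.[(y x)%:P] (s nu) (s x).
have Ac : ccvg (nbhs x) A P^`().[(y x)%:P].[s x].
  rewrite -divided_diff_deriv; apply: ccvg_horner_divided_diff => //.
  exact: ccvg_cst.
have Bc : ccvg (nbhs x) B P.[(y x)%:P]^`().[s x].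
  by rewrite -divided_diff_deriv; apply: ccvg_divided_diff => //; exact: ccvg_cst.
have A0 : \forall nu \near x, A nu != 0 by exact: ccvg_neq0 Ac Py.
exists (fun nu => - (B nu * g nu) / A nu).
  by apply: ccvgM; [apply: ccvgN; exact: ccvgM|exact: ccvgV].
have P0x := nbhs_singleton P0.
near=> nu.
have Anu : A nu != 0 by near: nu.
have e1 : P.[(y nu)%:P].[s nu] = 0 by near: nu.
have e2 : s nu = s x + g nu * (nu - x)%:C by near: nu.
have := ev_sub P (y nu) (y x) (s nu) (s x).
rewrite e1 P0x subrr -/(A nu) -/(B nu) e2 [s x + _]addrC addrK => e3.
apply: (mulIf Anu); rewrite mulrDl mulrAC divfK//.
have -> : y nu * A nu = y x * A nu + (y nu - y x) * A nu by ring.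
have -> : (y nu - y x) * A nu = - (g nu * (nu - x)%:C * B nu).
  by apply/eqP; rewrite -addr_eq0 -e3.
ring.
Unshelve. all: by end_near. Qed.

(** The derivative found by [implicit_cdiff] is a quotient of polynomials in [y] and [s] times [ds],
    hence differentiable itself. *)
Lemma implicit_c2diff P (y s ds : R -> C) x e :
  (forall nu, cdiff s nu (ds nu)) -> cdiff ds x e ->
  (\forall nu \near x, ccvg (nbhs nu) y (y nu)) ->
  (\forall nu \near x, P.[(y nu)%:P].[s nu] = 0) ->
  P^`().[(y x)%:P].[s x] != 0 -> c2diff y x.
Proof.
move=> sd dsd yc P0 Py.
have y0 := implicit_cdiff (sd x) (nbhs_singleton yc) P0 Py.
have P0' := near_join P0.
have Py' : \forall nu \near x, P^`().[(y nu)%:P].[s nu] != 0.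
  have [d' pd] := cdiff_horner2 P^`() y0 (sd x).
  exact: ccvg_neq0 (cdiff_cvg pd) Py.
exists (fun nu => - ((swapXY (swapXY P)^`()).[(y nu)%:P].[s nu] * ds nu) /
    P^`().[(y nu)%:P].[s nu]).
  near=> nu; rewrite -deriv_horner_polyC; apply: implicit_cdiff (sd nu) _ _ _; by near: nu.
have [d1 p1] := cdiff_horner2 P^`() y0 (sd x).
have [d2 p2] := cdiff_horner2 (swapXY (swapXY P)^`()) y0 (sd x).
eexists; apply: cdiffM; first by apply: cdiffN; apply: cdiffM; eassumption.
by apply: cdiffV => //; exact: p1.
Unshelve. all: by end_near. Qed.

(** The modulus of p(x) is the product of the distances from x to the n roots; if all were at least
    e, it would be at least e^n. *)
Lemma monic_root_near p (x : C) n (e : R) : p \is monic -> size p = n.+1 ->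
  0 <= e -> normc p.[x] < e ^+ n -> exists2 y, root p y & normc (y - x) < e.
Proof.
move=> pm sp e0 px; have [r pE] := closed_field_poly_normal p.
rewrite (monicP pm) scale1r in pE.
have sr : size r = n by move: sp; rewrite pE size_prod_XsubC => -[].
have [/hasP[y yr ye]|/hasPn far] := boolP (has (fun y => normc (y - x) < e) r).
  by exists y => //; rewrite pE root_prod_XsubC.
suff : e ^+ n <= normc p.[x] by rewrite leNgt px.
rewrite pE horner_prod -sr.
elim: r far {pE sr} => [|a r IH] far; first by rewrite big_nil normc1.
rewrite big_cons normcM exprS !hornerE; apply: ler_pM => //.
- by rewrite exprn_ge0.
- by rewrite normcB leNgt far// mem_head.
- by apply: IH => b br; rewrite far// in_cons br orbT.
Qed.

Lemma ccvg_harmonic (f : nat -> C) l :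
  (forall n, normc (f n - l) <= n.+1%:R^-1) -> ccvg \oo f l.
Proof.
move=> fl; apply: (ccvg_squeeze (g := fun n => n.+1%:R^-1)).
  exact: cvg_harmonic.
by near=> n; exact: fl.
Unshelve. all: by end_near. Qed.

(** On the diagonal at y0 the divided difference is the derivative. If no radius worked, bad triples
    at radii 1/(n+1) would converge to (y0, y0, x) and contradict continuity. The bound being
    uniform in all three arguments yields both uniqueness and continuity of the root. *)
Lemma divided_diff_lower_bound P (s : R -> C) x y0 :
  ccvg (nbhs x) s (s x) -> P^`().[y0%:P].[s x] != 0 ->
  exists2 e : R, 0 < e & forall y y1 nu, normc (y - y0) <= e ->
    normc (y1 - y0) <= e -> `|nu - x| <= e ->
    normc P^`().[y0%:P].[s x] / 2 <= normc (divided_diff P y%:P y1%:P).[s nu].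
Proof.
move=> sc P0; set c := normc _; have c0 : 0 < c by rewrite normc_gt0.
apply: contrapT => nex.
have bad n : exists w : C * C * R, [/\ normc (w.1.1 - y0) <= n.+1%:R^-1,
    normc (w.1.2 - y0) <= n.+1%:R^-1, `|w.2 - x| <= n.+1%:R^-1 &
    normc (divided_diff P w.1.1%:P w.1.2%:P).[s w.2] < c / 2].
  apply: contrapT => nw; apply: nex; exists n.+1%:R^-1; first by rewrite invr_gt0.
  move=> y y1 nu hy hy1 hnu; rewrite leNgt; apply/negP => h.
  by apply: nw; exists (y, y1, nu).
have [w wP] := choice bad.
have yc : ccvg \oo (fun n => (w n).1.1) y0.
  by apply: ccvg_harmonic => n; have [] := wP n.
have y1c : ccvg \oo (fun n => (w n).1.2) y0.
  by apply: ccvg_harmonic => n; have [] := wP n.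
have nuc : (w n).2 @[n --> \oo] --> x.
  apply/cvgrPdist_le => e e0.
  have : \forall n \near \oo, `|0 - harmonic n| <= e.
    exact: cvgr_dist_le (@cvg_harmonic R) _ e0.
  apply: filterS => n; rewrite sub0r normrN => h; rewrite distrC.
  have [_ _ h2 _] := wP n; apply: le_trans h2 _.
  by apply: le_trans h; rewrite ler_norm.
have snc : ccvg \oo (fun n => s (w n).2) (s x) by exact: ccvg_comp nuc sc.
have Ac : normc (divided_diff P (w n).1.1%:P (w n).1.2%:P).[s (w n).2] @[n --> \oo] --> c.
  rewrite /c -divided_diff_deriv.
  exact: ccvg_normc (ccvg_horner_divided_diff P yc y1c snc).
have c2 : 0 < c / 2 by rewrite divr_gt0.
have : \forall N \near \oo,
    `|c - normc (divided_diff P (w N).1.1%:P (w N).1.2%:P).[s (w N).2]| < c / 2.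
  exact: cvgr_dist_lt Ac _ c2.
case=> N _ /(_ N (leqnn N)) /=.
have [_ _ _ h1] := wP N; rewrite ltr_norml => /andP[_ h2].
lra.
Qed.

(** A root close to y0 exists because P(y0, s) is small and the polynomial is monic of constant
    degree; the lower bound on the divided difference makes it unique and Lipschitz in [s]. *)
Lemma implicit_exists P (s : R -> C) n y0 x :
  (forall nu, map_poly (horner_eval (s nu)) P \is monic) ->
  (forall nu, size (map_poly (horner_eval (s nu)) P) = n.+1) ->
  (forall nu, ccvg (nbhs nu) s (s nu)) ->
  P.[y0%:P].[s x] = 0 -> P^`().[y0%:P].[s x] != 0 ->
  exists y : R -> C, [/\ y x = y0,
    \forall nu \near x, P.[(y nu)%:P].[s nu] = 0 &
    \forall nu \near x, ccvg (nbhs nu) y (y nu)].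
Proof.
move=> Pm Ps sc P0 P'0.
have [e e0 Ae] := divided_diff_lower_bound (sc x) P'0.
set c := normc _ / 2 in Ae; have c0 : 0 < c by rewrite divr_gt0// normc_gt0.
have root_near nu : normc P.[y0%:P].[s nu] < e ^+ n ->
    exists2 y, P.[y%:P].[s nu] = 0 & normc (y - y0) < e.
  rewrite -horner_eval_map => h.
  have [y /rootP] := monic_root_near (Pm nu) (Ps nu) (ltW e0) h.
  by rewrite horner_eval_map; exists y.
pose Q nu y := P.[y%:P].[s nu] = 0 /\ normc (y - y0) < e.
(* For two roots at the same s, [ev_sub] leaves (y - y1) times a divided difference that the lower
   bound keeps away from 0. *)
have uniq nu y y1 : `|nu - x| <= e -> Q nu y -> Q nu y1 -> y = y1.
  move=> he [Py hy] [Py1 hy1].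
  have := ev_sub P y y1 (s nu) (s nu); rewrite Py Py1 !subrr mul0r addr0.
  move/esym/eqP; rewrite mulf_eq0 subr_eq0 => /orP[/eqP//|/eqP A0].
  have := Ae y y1 nu (ltW hy) (ltW hy1) he.
  by rewrite A0 (normc0 R) leNgt c0.
pose y nu := xget y0 [set y | Q nu y].
have yQ : \forall nu \near x, Q nu (y nu).
  have H0 : normc P.[y0%:P].[s nu] @[nu --> x] --> (0 : R).
    have -> : 0 = normc P.[y0%:P].[s x] by rewrite P0; exact/esym/normc0.
    exact: ccvg_normc (ccvg_horner P.[y0%:P] (sc x)).
  have en : 0 < e ^+ n by rewrite exprn_gt0.
  have : \forall nu \near x, `|0 - normc P.[y0%:P].[s nu]| < e ^+ n.
    exact: cvgr_dist_lt H0 _ en.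
  apply: filterS => nu.
  rewrite sub0r normrN ger0_norm ?normc_ge0// => h.
  have [z z0 ze] := root_near nu h.
  by apply: (xgetPex y0); exists z.
exists y; split.
- apply: (uniq x); first by rewrite subrr normr0 ltW.
    exact: nbhs_singleton yQ.
  by split => //; rewrite subrr (normc0 R).
- by apply: filterS yQ => nu [].
have near_e : \forall nu \near x, `|nu - x| <= e.
  near=> nu; rewrite distrC; near: nu.
  by apply: (@cvgr_dist_le _ _ _ _ _ id x) e0; exact: cvg_id.
(* Continuity is claimed at every [nu] near [x], so the defining property must hold on a
   neighbourhood of each such [nu]. *)
have yQ' := near_join yQ; have near_e' := near_join near_e.
near=> nu.
pose B t := divided_diff P.[(y nu)%:P] (s t) (s nu).
have lip : \forall t \near nu, normc (y t - y nu) <= normc ((s t - s nu) * B t) / c.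
  have h1 : \forall t \near nu, Q t (y t) by near: nu.
  have h2 : \forall t \near nu, `|t - x| <= e by near: nu.
  have [Pnu hnu] := nbhs_singleton h1.
  near=> t.
  have [Pt ht] : Q t (y t) by near: t.
  have he : `|t - x| <= e by near: t.
  have := ev_sub P (y t) (y nu) (s t) (s nu); rewrite Pnu Pt subrr => /esym/eqP.
  rewrite addrC addr_eq0 => /eqP ->; rewrite normcN normcM ler_pdivlMr//.
  by rewrite ler_wpM2l ?normc_ge0// Ae// ltW.
apply: ccvg_squeeze lip.
have sB : ccvg (nbhs nu) (fun t => (s t - s nu) * B t) 0.
  rewrite -(mul0r P.[(y nu)%:P]^`().[s nu]) -divided_diff_deriv.
  apply: ccvgM; first by rewrite -(subrr (s nu)); apply: ccvgB => //; exact: ccvg_cst.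
  by apply: ccvg_divided_diff => //; exact: ccvg_cst.
rewrite -(mul0r c^-1); apply: cvgM; last exact: cvg_cst.
rewrite -(normc0 R); exact: ccvg_normc sB.
Unshelve. all: by end_near. Qed.

End ImplicitPolynomial.

(** * Eigenvectors depending polynomially on the matrix and the eigenvalue *)

Section Eigenvector.
Variables (F : fieldType) (n : nat).
Implicit Types (A : 'M[F]_n.+1) (v : 'cV[F]_n.+1) (p : {poly F}) (y : F).

(* [q(A) v], where [p - p.[y] = ('X - y) q]. *)
Definition cofactor_vec p A y v : 'cV[F]_n.+1 :=
  \sum_(j < size p) p`_j *: \sum_(i < j) y ^+ i *: (A ^+ (j.-1 - i) *m v).

Lemma cofactor_vecE p A y v i k : cofactor_vec p A y v i k =
  \sum_(j < size p) p`_j * \sum_(e < j) y ^+ e * (A ^+ (j.-1 - e) *m v) i k.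
Proof.
rewrite summxE; apply: eq_bigr => j _; rewrite mxE summxE; congr (_ * _).
by apply: eq_bigr => e _; rewrite mxE.
Qed.

Lemma cofactor_vecP p A y v :
  A *m cofactor_vec p A y v - y *: cofactor_vec p A y v =
  horner_mx A p *m v - p.[y] *: v.
Proof.
have -> : horner_mx A p = \sum_(j < size p) p`_j *: A ^+ j.
  rewrite -[in LHS](coefK p) poly_def rmorph_sum; apply: eq_bigr => j _.
  by rewrite /= linearZ /= rmorphXn /= horner_mx_X.
rewrite horner_coef mulmx_sumr mulmx_suml scaler_sumr scaler_suml -!sumrB.
apply: eq_bigr => j _.
rewrite -scalemxAr -scalemxAl scalerA [y * _]mulrC -!scalerA -!scalerBr.
congr (_ *: _).
have -> : A ^+ j *m v - y ^+ j *: v = (A ^+ j - y%:M ^+ j) *m v.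
  by rewrite mulmxBl -!rmorphXn /= mul_scalar_mx.
rewrite subrXX_comm; last exact: scalar_mxC.
rewrite -mulmxA mulmxBl mul_scalar_mx; congr (_ *m _ - _ *: _);
  rewrite mulmx_suml; apply: eq_bigr => i _;
  by rewrite -mulmxA -rmorphXn /= mul_scalar_mx -scalemxAr.
Qed.

(** In [cofactor_vecP] the term p(A) v vanishes by Cayley-Hamilton and p(y) v because y is a
    root. *)
Lemma char_poly_cofactor_vec A y v : root (char_poly A) y ->
  A *m cofactor_vec (char_poly A) A y v = y *: cofactor_vec (char_poly A) A y v.
Proof.
move=> /rootP r; apply/eqP; rewrite -subr_eq0 cofactor_vecP.
by rewrite Cayley_Hamilton mul0mx r scale0r subr0.
Qed.

(** On a fixed vector, q(A) acts as the scalar q(1) = p'(1). At a simple root this is nonzero, so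
    the construction does not degenerate. *)
Lemma cofactor_vec_fixed p A v : A *m v = v ->
  cofactor_vec p A 1 v = p^`().[1] *: v.
Proof.
move=> Av; have Akv k : A ^+ k *m v = v.
  by elim: k => [|k IH]; rewrite ?expr0 ?mul1mx// exprSr -mulmxA Av.
rewrite -divided_diff_deriv scaler_suml; apply: eq_bigr => j _.
rewrite -scalerA; congr (_ *: _); rewrite scaler_suml; apply: eq_bigr => i _.
by rewrite Akv !expr1n mulr1.
Qed.

End Eigenvector.

Section EigenvectorLimit.
Variables (R : realType) (n : nat).
Local Notation C := R[i].
Context (T : Type) (F : set_system T) {FF : Filter F}.

Definition mccvg m k (A : T -> 'M[C]_(m, k)) (B : 'M[C]_(m, k)) :=
  forall i j, ccvg F (fun x => A x i j) (B i j).

Lemma mccvgM m k l (A : T -> 'M[C]_(m, k)) (B : T -> 'M[C]_(k, l)) A0 B0 :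
  mccvg A A0 -> mccvg B B0 -> mccvg (fun x => A x *m B x) (A0 *m B0).
Proof.
move=> Ac Bc i j; rewrite mxE; under eq_fun do rewrite mxE.
by apply: ccvg_sum => e _; exact: ccvgM.
Qed.

Lemma mccvgZ k l (a : C) (B : T -> 'M[C]_(k, l)) B0 :
  mccvg B B0 -> mccvg (fun x => a *: B x) (a *: B0).
Proof.
move=> Bc i j; rewrite mxE; under eq_fun do rewrite mxE.
by apply: ccvgM; [exact: ccvg_cst|exact: Bc].
Qed.

Lemma mccvgX (A : T -> 'M[C]_n.+1) A0 k :
  mccvg A A0 -> mccvg (fun x => A x ^+ k) (A0 ^+ k).
Proof.
move=> Ac; elim: k => [|k IH]; first by move=> i j; exact: ccvg_cst.
by rewrite exprS; under eq_fun do rewrite exprS; exact: mccvgM.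
Qed.

(** Equal sizes fix the range of the outer sum, so that the limit can be taken term by term. *)
Lemma mccvg_cofactor_vec (p : T -> {poly C}) (p0 : {poly C}) (A : T -> 'M[C]_n.+1) A0 y y0 v :
  (forall x, size (p x) = size p0) ->
  (forall j : nat, ccvg F (fun x => (p x)`_j) p0`_j) -> mccvg A A0 -> ccvg F y y0 ->
  mccvg (fun x => cofactor_vec (p x) (A x) (y x) v) (cofactor_vec p0 A0 y0 v).
Proof.
move=> ps pc Ac yc i l; rewrite cofactor_vecE.
under eq_fun do rewrite cofactor_vecE ps.
apply: ccvg_sum => j _; apply: ccvgM; first exact: pc.
apply: ccvg_sum => e _; apply: ccvgM; first exact: ccvgX.
apply: mccvgM; first exact: mccvgX.
by move=> a b; exact: ccvg_cst.
Qed.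

End EigenvectorLimit.

(** * The Hilbert-Schmidt norm and Kraus sums *)

Section Kraus.
Variables (F : numClosedFieldType).
Implicit Types (n m : nat).

Lemma trmxC_mul m n k (X : 'M[F]_(m, n)) (Y : 'M[F]_(n, k)) :
  (X *m Y)^t* = Y^t* *m X^t*.
Proof. by rewrite trmx_mul map_mxM. Qed.

Lemma trmxCB m n (X Y : 'M[F]_(m, n)) : (X - Y)^t* = X^t* - Y^t*.
Proof. by rewrite linearB /= map_mxB. Qed.

Lemma trmxCZ m n (a : F) (X : 'M[F]_(m, n)) : (a *: X)^t* = a^* *: X^t*.
Proof. by rewrite linearZ /= map_mxZ. Qed.

Lemma trmxC_sum m n (I : finType) (X : I -> 'M[F]_(m, n)) :
  (\sum_i X i)^t* = \sum_i (X i)^t*.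
Proof. by rewrite linear_sum /= raddf_sum. Qed.

Definition hsnorm2 n (X : 'M[F]_n) : F := \tr (X *m X^t*).

Lemma hsnorm2E n (X : 'M[F]_n) : hsnorm2 X = \sum_i \sum_j `|X i j| ^+ 2.
Proof.
apply: eq_bigr => i _; rewrite mxE; apply: eq_bigr => j _.
by rewrite !mxE normCK.
Qed.

Lemma hsnorm2_ge0 n (X : 'M[F]_n) : 0 <= hsnorm2 X.
Proof.
by rewrite hsnorm2E; do 2![apply: sumr_ge0 => ? _]; rewrite exprn_ge0.
Qed.

Lemma hsnorm2_entry n (X : 'M[F]_n) i j : `|X i j| ^+ 2 <= hsnorm2 X.
Proof.
rewrite hsnorm2E (bigD1 i)//= (bigD1 j)//= -addrA lerDl addr_ge0//.
  by apply: sumr_ge0 => ? _; rewrite exprn_ge0.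
by do 2![apply: sumr_ge0 => ? _]; rewrite exprn_ge0.
Qed.

Lemma hsnorm2Z n (a : F) (X : 'M[F]_n) : hsnorm2 (a *: X) = `|a| ^+ 2 * hsnorm2 X.
Proof.
rewrite !hsnorm2E mulr_sumr; apply: eq_bigr => i _; rewrite mulr_sumr.
by apply: eq_bigr => j _; rewrite mxE normrM exprMn.
Qed.

Lemma hsnorm2_eq0 n (X : 'M[F]_n) : hsnorm2 X = 0 -> X = 0.
Proof.
move=> X0; apply/matrixP => i j; rewrite mxE; apply/eqP.
have := hsnorm2_entry X i j; rewrite X0 => h.
by rewrite -normr_eq0 -sqrf_eq0 eq_le h exprn_ge0.
Qed.

(* Expand [0 <= sum_i |K_i^* C - B G_i^*|^2] with [C] the left-hand operator. *)
Lemma kraus_contraction n m (K G : 'I_m -> 'M[F]_n) (B : 'M[F]_n) :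
  \sum_i K i *m (K i)^t* = 1%:M -> \sum_i (G i)^t* *m G i = 1%:M ->
  hsnorm2 (\sum_i K i *m B *m (G i)^t*) <= hsnorm2 B.
Proof.
move=> KK GG; set C := \sum_i _.
have CC : C^t* = \sum_i G i *m B^t* *m (K i)^t*.
  rewrite trmxC_sum; apply: eq_bigr => i _.
  by rewrite !trmxC_mul trmxCK mulmxA.
have : 0 <= \sum_i hsnorm2 ((K i)^t* *m C - B *m (G i)^t*).
  by apply: sumr_ge0 => i _; exact: hsnorm2_ge0.
have e i : hsnorm2 ((K i)^t* *m C - B *m (G i)^t*) =
    \tr ((K i *m (K i)^t*) *m (C *m C^t*)) - \tr (C *m (G i *m B^t* *m (K i)^t*))
    - \tr ((K i *m B *m (G i)^t*) *m C^t*) + \tr (B *m ((G i)^t* *m G i) *m B^t*).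
  rewrite /hsnorm2 trmxCB !trmxC_mul !trmxCK mulmxBl !mulmxBr !linearB /=.
  rewrite [\tr ((K i)^t* *m C *m (C^t* *m K i))]mxtrace_mulC.
  have -> : \tr ((K i)^t* *m C *m (G i *m B^t*)) = \tr (C *m (G i *m B^t* *m (K i)^t*)).
    by rewrite -mulmxA mxtrace_mulC !mulmxA.
  have -> : \tr (B *m (G i)^t* *m (C^t* *m K i)) = \tr ((K i *m B *m (G i)^t*) *m C^t*).
    by rewrite [LHS]mxtrace_mulC -!mulmxA [LHS]mxtrace_mulC !mulmxA.
  have -> : \tr (C^t* *m K i *m ((K i)^t* *m C)) = \tr ((K i *m (K i)^t*) *m (C *m C^t*)).
    by rewrite -!mulmxA [LHS]mxtrace_mulC !mulmxA.
  by rewrite !mulmxA; ring.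
(* Summed over i, the first three traces all become |C|^2, with signs +, -, -, and the last becomes
   |B|^2; what remains is |B|^2 - |C|^2. *)
rewrite (eq_bigr _ (fun i _ => e i)) big_split /= !sumrB -!linear_sum /=.
rewrite -!mulmx_suml -!mulmx_sumr -CC KK GG mul1mx mulmx1 -/C.
by rewrite -/(hsnorm2 C) -/(hsnorm2 B) subrr sub0r addrC subr_ge0.
Qed.

End Kraus.

(** * The superoperator, its dependence on the momentum shift, and its dual *)

Section Superoperator.
Variables (R : realType) (U : 'M[R[i]]_2) (m : nat) (A : 'I_m -> 'M[R[i]]_2).
Local Notation C := R[i].
Hypothesis (U_unitary : U \is unitarymx) (A_unital : unital_measurement A).
Implicit Types (B : 'M[C]_2) (k x : R).

Lemma conjC_conjc (z : C) : Num.conj z = conjc z.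
Proof. by []. Qed.

Lemma cexpi0 : cexpi (0 : R) = 1.
Proof. by rewrite cexpiE cos0 sin0. Qed.

Lemma cexpiD (x y : R) : cexpi (x + y) = cexpi x * cexpi y.
Proof. by rewrite !cexpiE; apply: complex_ext; rewrite !ReImE /= ?cosD ?sinD; ring. Qed.

Lemma cexpiN (x : R) : cexpi (- x) = (cexpi x)^*.
Proof. by rewrite !cexpiE cosN sinN. Qed.

Lemma cexpi_neq0 (x : R) : cexpi x != 0.
Proof.
apply/eqP => e; have := cexpiD x (- x); rewrite subrr cexpi0 e mul0r => /eqP.
by rewrite oner_eq0.
Qed.

Lemma cexpiNV (x : R) : cexpi (- x) = (cexpi x)^-1.
Proof.
by apply: (mulfI (cexpi_neq0 x)); rewrite -cexpiD subrr cexpi0 mulfV ?cexpi_neq0.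
Qed.

Definition shiftmx x : 'M[C]_2 := cexpi (- x) *: PR R + cexpi x *: PL R.

Lemma PRR : PR R *m PR R = PR R. Proof. by rewrite mul_delta_mx. Qed.
Lemma PLL : PL R *m PL R = PL R. Proof. by rewrite mul_delta_mx. Qed.
Lemma PRL : PR R *m PL R = 0. Proof. by rewrite mul_delta_mx_0. Qed.
Lemma PLR : PL R *m PR R = 0. Proof. by rewrite mul_delta_mx_0. Qed.
Definition projE := (PRR, PLL, PRL, PLR).

Lemma PR_PL : PR R + PL R = 1%:M.
Proof.
apply/matrixP => i j; rewrite !mxE.
by case: i => [[|[|[]]]] //= ?; case: j => [[|[|[]]]] //= ?; rewrite ?addr0 ?add0r.
Qed.

Lemma PR_adj : (PR R)^t* = PR R.
Proof. by rewrite /PR trmx_delta map_delta_mx. Qed.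

Lemma PL_adj : (PL R)^t* = PL R.
Proof. by rewrite /PL trmx_delta map_delta_mx. Qed.

Lemma shiftmxD x y : shiftmx (x + y) = shiftmx x *m shiftmx y.
Proof.
rewrite /shiftmx mulmxDl !mulmxDr -!scalemxAl -!scalemxAr !projE !scaler0.
by rewrite addr0 add0r !scalerA -!cexpiD opprD.
Qed.

Lemma shiftmx_adj x : (shiftmx x)^t* = shiftmx (- x).
Proof.
rewrite /shiftmx linearD /= !linearZ /= map_mxD !map_mxZ /=.
by rewrite PR_adj PL_adj !conjC_conjc -!cexpiN.
Qed.

Lemma shiftmx0 : shiftmx 0 = 1%:M.
Proof. by rewrite /shiftmx oppr0 cexpi0 !scale1r PR_PL. Qed.

Lemma UkE k : Uk U k = shiftmx k *m U.
Proof. by []. Qed.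

Lemma Uk_shift k x : (Uk U (k + x))^t* = (Uk U k)^t* *m shiftmx (- x).
Proof.
by rewrite !UkE addrC shiftmxD -mulmxA trmxC_mul shiftmx_adj.
Qed.

Lemma Uk_unitary k : Uk U k *m (Uk U k)^t* = 1%:M.
Proof.
rewrite UkE trmxC_mul mulmxA -[_ *m _ *m U^t*]mulmxA (unitarymxP U_unitary) mulmx1.
by rewrite shiftmx_adj -shiftmxD subrr shiftmx0.
Qed.

Lemma Uk_unitary' k : (Uk U k)^t* *m Uk U k = 1%:M.
Proof. by apply: mulmx1C; exact: Uk_unitary. Qed.

Lemma UkA_adj k n : (Uk U k *m A n)^t* = (A n)^t* *m (Uk U k)^t*.
Proof. exact: trmxC_mul. Qed.

Lemma UkA_gram k n : (Uk U k *m A n)^t* *m (Uk U k *m A n) = (A n)^t* *m A n.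
Proof.
rewrite UkA_adj; have := Uk_unitary' k; move: (Uk U k) => V VV.
by rewrite -!mulmxA [V^t* *m _]mulmxA VV mul1mx.
Qed.

Lemma superopE k k' B : superop U A k k' B =
  \sum_(n < m) (Uk U k *m A n) *m B *m (Uk U k' *m A n)^t*.
Proof. by apply: eq_bigr => n _; rewrite UkA_adj !mulmxA. Qed.

Lemma superop_linear k k' : linear (superop U A k k').
Proof.
move=> a B D; rewrite /superop scaler_sumr -big_split; apply: eq_bigr => n _.
by rewrite /= mulmxDr -scalemxAr !mulmxDl -!scalemxAl.
Qed.

HB.instance Definition _ k k' := GRing.isLinear.Build C 'M[C]_2 'M[C]_2 _
  (superop U A k k') (superop_linear k k').

Lemma mul_superop_mx k k' B :
  mxvec B *m superop_mx U A k k' = mxvec (superop U A k k' B).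
Proof. exact: mul_vec_lin. Qed.

(** The whole dependence on x sits in one diagonal right factor, with entries e^{ix} and e^{-ix}. *)
Lemma superop_shift k x B :
  superop U A k (k + x) B = superop U A k k B *m shiftmx (- x).
Proof.
rewrite /superop mulmx_suml; apply: eq_bigr => n _.
by rewrite Uk_shift !mulmxA.
Qed.

Lemma superop_shift2 k x B : superop U A k (k + x) B =
  cexpi x *: (superop U A k k B *m PR R) + (cexpi x)^-1 *: (superop U A k k B *m PL R).
Proof.
rewrite superop_shift; move: (superop U A k k B) => D.
by rewrite /shiftmx opprK mulmxDr -cexpiNV scalemxAr scalemxAr.
Qed.

(** Two Kraus families occur because the two momenta differ: unitality is used on the left one,
    trace preservation on the right one. *)
Lemma superop_contraction k k' B :
  hsnorm2 (superop U A k k' B) <= hsnorm2 B.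
Proof.
rewrite superopE; apply: kraus_contraction.
  rewrite (eq_bigr (fun n => Uk U k *m (A n *m (A n)^t*) *m (Uk U k)^t*)).
    by rewrite -mulmx_suml -mulmx_sumr A_unital.2 mulmx1 Uk_unitary.
  by move=> n _; rewrite UkA_adj !mulmxA.
rewrite (eq_bigr (fun n => (A n)^t* *m A n)) ?A_unital.1// => n _.
exact: UkA_gram.
Qed.

Lemma superop_trace k B : \tr (superop U A k k B) = \tr B.
Proof.
rewrite superopE linear_sum /=.
rewrite (eq_bigr (fun n => \tr (B *m ((A n)^t* *m A n)))).
  by rewrite -linear_sum -mulmx_sumr A_unital.1 mulmx1.
by move=> n _; rewrite -mulmxA mxtrace_mulC -mulmxA UkA_gram.
Qed.

Lemma superop_id k : superop U A k k 1%:M = 1%:M.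
Proof.
rewrite superopE.
rewrite (eq_bigr (fun n => Uk U k *m (A n *m (A n)^t*) *m (Uk U k)^t*)).
  by rewrite -mulmx_suml -mulmx_sumr A_unital.2 mulmx1 Uk_unitary.
by move=> n _; rewrite mulmx1 UkA_adj !mulmxA.
Qed.

Lemma superop_iter_contraction k k' B t :
  hsnorm2 (iter t (superop U A k k') B) <= hsnorm2 B.
Proof.
elim: t => //= t IH; exact: le_trans (superop_contraction _ _ _) IH.
Qed.

(** The bound depends neither on the momenta nor on t. It serves twice: for the remainder in
    [trace_iter_cvg] and for dominated convergence. *)
Lemma normc_iter_entry k k' B t i j :
  normc (iter t (superop U A k k') B i j) <= Num.sqrt (complex.Re (hsnorm2 B)).
Proof.
have := le_trans (hsnorm2_entry (iter t (superop U A k k') B) i j)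
  (superop_iter_contraction k k' B t).
rewrite lecE => /andP[_]; rewrite normc_def -normc_sqrt -rmorphXn /= => h.
by rewrite -[leLHS]ger0_norm ?normc_ge0// -sqrtr_sqr ler_wsqrtr.
Qed.

(** [superop_mx] acts on rows, so columns are linear functionals on operators; this one is the
    trace. *)
Definition trvec : 'cV[C]_(2 * 2) := (mxvec (1%:M : 'M[C]_2))^T.

Lemma mxvec_mul (v : 'cV[C]_(2 * 2)) B :
  mxvec B *m v = (\sum_i \sum_j B i j * v (mxvec_index i j) 0)%:M.
Proof.
apply/matrixP => a b; rewrite !ord1 !mxE eqxx mulr1n.
rewrite pair_bigA /= (reindex (uncurry (@mxvec_index 2 2))) /=; last first.
  exact: curry_mxvec_bij.
by apply: eq_bigr => -[i j] _; rewrite /= mxvecE.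
Qed.

Lemma mxvec_trvec B : mxvec B *m trvec = (\tr B)%:M.
Proof.
rewrite mxvec_mul; congr _%:M; apply: eq_bigr => i _.
rewrite (bigD1 i)//= big1 => [|j ij]; rewrite mxE mxvecE mxE.
  by rewrite eqxx mulr1 addr0.
by rewrite eq_sym (negbTE ij) mulr0.
Qed.

Lemma mxvec_diag_mul (a b : C) (v : 'cV[C]_(2 * 2)) :
  mxvec (a *: PR R + b *: PL R) *m v =
  (a * v (mxvec_index 0 0) 0 + b * v (mxvec_index 1 1) 0)%:M.
Proof.
rewrite linearD !linearZ /= !mxvec_delta mulmxDl -!scalemxAl -!rowE.
by apply/matrixP => i j; rewrite !ord1 !mxE mulr1n.
Qed.

Lemma mxvec_ext (v w : 'cV[C]_(2 * 2)) :
  (forall B, mxvec B *m v = mxvec B *m w) -> v = w.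
Proof.
move=> h; apply/colP => i; have := h (vec_mx (delta_mx 0 i)).
by rewrite vec_mxK -!rowE => /rowP/(_ 0); rewrite !mxE.
Qed.

Lemma superop_mx_trvec k : superop_mx U A k k *m trvec = trvec.
Proof.
apply: mxvec_ext => B; rewrite mulmxA mul_superop_mx !mxvec_trvec.
by rewrite superop_trace.
Qed.

Lemma mul_iter_superop_mx k k' B t (v : 'cV[C]_(2 * 2)) a :
  superop_mx U A k k' *m v = a *: v ->
  mxvec (iter t (superop U A k k') B) *m v = a ^+ t *: (mxvec B *m v).
Proof.
move=> av; elim: t => [|t IH]; first by rewrite expr0 scale1r.
by rewrite /= -mul_superop_mx -mulmxA av -scalemxAr IH scalerA exprS.
Qed.

End Superoperator.

(** * Second-order Taylor expansion at 0 *)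

Section Taylor.
Variable R : realType.
Implicit Types (f : R -> R).

Lemma MVT_bound0 f (df : R -> R) (M x : R) :
  (forall y : R, `|y| <= `|x| -> is_derive y 1 f (df y) /\ `|df y| <= M) ->
  `|f x - f 0| <= M * `|x|.
Proof.
move=> H.
have main a b : a <= b -> (forall y, a <= y <= b -> `|y| <= `|x|) ->
    `|f b - f a| <= M * `|b - a|.
  move=> ab sub.
  have [||c cab ->] := @MVT_segment R f df a b ab.
  - move=> y; rewrite in_itv /= => /andP[ya yb].
    by have [] := H y (sub y _); rewrite ?(ltW ya) ?(ltW yb).
  - apply: derivable_within_continuous => y; rewrite in_itv /= => yab.
    by have [[]] := H y (sub y yab).
  rewrite normrM ler_wpM2r//; move: cab; rewrite in_itv /= => cab.
  by have [] := H c (sub c cab).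
have [x0|x0] := leP 0 x.
  have := main 0 x x0; rewrite subr0; apply => y /andP[y0 yx].
  by rewrite !ger0_norm.
have := main x 0 (ltW x0); rewrite distrC sub0r normrN; apply => y /andP[xy y0].
by rewrite !ler0_norm ?lerN2// ltW.
Qed.

(** The second derivative is available at 0 only. It gives f'(y) = g(y) y with g continuous at 0,
    and the mean value bound is applied to f minus its quadratic part. *)
Lemma taylor2 f : twice_derivable f 0 -> derive1 f 0 = 0 ->
  (f x - f 0) / x ^+ 2 @[x --> 0^'] --> derive1n 2 f 0 / 2.
Proof.
move=> [fd f'd] f'0; set a := derive1n 2 f 0.
have [g [gE gc g0]] : exists g, [/\ forall z, derive1 f z - derive1 f 0 = g z * (z - 0),
    {for 0, continuous g} & g 0 = a].
  by apply/is_derive1_caratheodory; rewrite /a /derive1n /= derive1E; exact/derivableP.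
apply/cvgrPdist_le => e e0.
have gn : \forall y \near 0, `|a - g y| <= e.
  by rewrite -g0; exact: cvgr_dist_le gc _ e0.
have /nbhs_normP[d /= d0 dP] : \forall y \near (0 : R), derivable f y 1 /\ `|a - g y| <= e.
  by near=> y; split; near: y.
have xd : \forall x \near (0 : R)^', `|x| < d.
  apply: cvg_within; apply/nbhs_normP; exists d => // y /=.
  by rewrite sub0r normrN.
near=> x.
have x0 : x != 0 by near: x; exact: nbhs_dnbhs_neq.
have xd' : `|x| < d by near: x.
pose phi y := f y - (a / 2) * y ^+ 2.
(* The derivative of [phi] at y is (g(y) - a) y, at most e |x| in modulus when |y| <= |x|. *)
have bnd : `|phi x - phi 0| <= (e * `|x|) * `|x|.
  apply: (@MVT_bound0 _ (fun y => derive1 f y - a * y)) => y yx.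
  have [fy gy] : derivable f y 1 /\ `|a - g y| <= e.
    by apply: dP; rewrite /= sub0r normrN; exact: le_lt_trans xd'.
  split.
    have f1 : is_derive y 1 f (derive1 f y) by rewrite derive1E; exact/derivableP.
    by rewrite /phi; apply: is_derive_eq; rewrite /GRing.scale /= mulr1; field.

  have e1 : derive1 f y - a * y = (g y - a) * y.
    by have := gE y; rewrite f'0 !subr0 mulrBl => ->.
  rewrite e1.
  by rewrite normrM distrC ler_pM.
have -> : a / 2 - (f x - f 0) / x ^+ 2 = - ((phi x - phi 0) / x ^+ 2).
  by rewrite /phi; field.
rewrite normrN normrM normfV normrX ler_pdivrMr ?exprn_gt0 ?normr_gt0//.
by rewrite expr2 mulrA.
Unshelve. all: by end_near. Qed.

End Taylor.

(** * Powers converging to a complex exponential *)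

Section ComplexExponential.
Variable R : realType.
Local Notation C := R[i].
Implicit Types (z w c : C).

Lemma cexp0 : cexp (0 : C) = 1.
Proof. by apply: complex_ext; rewrite /= ?expR0 ?cos0 ?sin0 mul1r. Qed.

Lemma cexpD z w : cexp (z + w) = cexp z * cexp w.
Proof.
by apply: complex_ext; rewrite !ReImE /= !ReImE expRD ?cosD ?sinD; ring.
Qed.

Lemma cexpMn z n : cexp (z *+ n) = cexp z ^+ n.
Proof. by elim: n => [|n IH]; rewrite ?cexp0// mulrS cexpD IH exprS. Qed.

Lemma normc_cexp z : normc (cexp z) = expR (complex.Re z).
Proof.
rewrite /= !exprMn -mulrDr cos2Dsin2 mulr1 sqrtr_sqr.
by rewrite ger0_norm// expR_ge0.
Qed.

Lemma cdiff_cexpZ c : cdiff (fun r : R => cexp (r%:C * c)) 0 c.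
Proof.
have e (r : R) : r%:C * c = (r * complex.Re c) +i* (r * complex.Im c).
  by apply: complex_ext; rewrite !ReImE /=; ring.
apply/cdiffP; split; under eq_fun do rewrite e /=.
  apply: is_derive_eq; rewrite !mul0r expR0 cos0 sin0 /GRing.scale /=; ring.
apply: is_derive_eq; rewrite !mul0r expR0 cos0 sin0 /GRing.scale /=; ring.
Qed.

(** Factor out w - z: the cofactor is a sum of n monomials of modulus at most 1. *)
Lemma normc_subXX w z n : normc w <= 1 -> normc z <= 1 ->
  normc (w ^+ n - z ^+ n) <= n%:R * normc (w - z).
Proof.
move=> w1 z1; rewrite subrXX normcM mulrC ler_wpM2r ?normc_ge0//.
apply: le_trans (normc_sum _ _ _) _.
rewrite -[in leRHS](card_ord n) -sum1_card natr_sum; apply: ler_sum => i _.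
rewrite normcM !normcX -[1%:R]mulr1; apply: ler_pM => //; rewrite ?exprn_ge0 ?normc_ge0//.
  by rewrite exprn_ile1 ?normc_ge0.
by rewrite exprn_ile1 ?normc_ge0.
Qed.

Lemma cvg_invn : (n%:R^-1 : R) @[n --> \oo] --> (0 : R).
Proof.
apply/gtr0_cvgV0; last exact: cvgr_idn.
by near=> n; rewrite ltr0n; near: n; exact: nbhs_infty_gt.
Unshelve. all: by end_near. Qed.

Lemma natC (n : nat) : (n%:R : C) = (n%:R : R)%:C.
Proof. by rewrite rmorph_nat. Qed.

(* [w^n - exp(c/n)^n] is controlled by [n (w - exp(c/n))], both bases lying in
   the unit disc. *)
Lemma ccvg_pow_cexp (w : nat -> C) c :
  (\forall n \near \oo, normc (w n) <= 1) ->
  ccvg \oo (fun n => n%:R * (w n - 1)) c ->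
  complex.Re c <= 0 /\ ccvg \oo (fun n => w n ^+ n) (cexp c).
Proof.
move=> w1 wc.
(* The real part of n (w_n - 1) is nonpositive since |w_n| <= 1. The sign of the limit is what puts
   exp(c/n) in the unit disc. *)
have c0 : complex.Re c <= 0.
  apply: cvgr_to_le wc.1 _; near=> n.
  have h : normc (w n) <= 1 by near: n.
  rewrite natC !ReImE /= mul0r subr0 mulr_ge0_le0 ?ler0n// subr_le0.
  exact: le_trans (ler_norm _) (le_trans (Re_le_normc _) h).
split=> //; pose z n := cexp ((n%:R^-1 : R)%:C * c).
have z1 n : normc (z n) <= 1.
  rewrite normc_cexp -expR0 ler_expR !ReImE /= mul0r subr0.
  by rewrite mulr_ge0_le0// invr_ge0 ler0n.
have zE n : (0 < n)%N -> z n ^+ n = cexp c.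
  move=> n0; rewrite -cexpMn -[X in cexp X]mulr_natl mulrA natC -rmorphM /= mulfV ?mul1r//.
  by rewrite pnatr_eq0 -lt0n.
have zc : ccvg \oo (fun n => n%:R * (z n - 1)) c.
  have [g gc gE] := cdiff_cexpZ c.
  apply: (near_eq_ccvg (f := fun n => g (n%:R^-1))); last exact: ccvg_comp cvg_invn gc.
  have gE' := cvg_invn gE.
  near=> n.
  have n0 : (0 < n)%N by near: n; exact: nbhs_infty_gt.
  have -> : z n = cexp (0%:C * c) + g (n%:R^-1) * (n%:R^-1 - 0)%:C by near: n.
  rewrite mul0r cexp0 addrAC subrr add0r subr0 mulrCA natC -rmorphM /= mulfV ?mulr1//.
  by rewrite pnatr_eq0 -lt0n.
apply: (ccvg_squeeze (g := fun n => normc (n%:R * (w n - 1) - n%:R * (z n - 1)))).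
  by rewrite -(normc0 R); apply: ccvg_normc; rewrite -(subrr c); exact: ccvgB.
near=> n.
have n0 : (0 < n)%N by near: n; exact: nbhs_infty_gt.
rewrite -(zE n)//; apply: le_trans (normc_subXX _ _ (z1 n)) _; first by near: n.
rewrite -mulrBr normcM natC normc_real normr_nat opprB addrA subrK.
by rewrite lexx.
Unshelve. all: by end_near. Qed.

End ComplexExponential.

(** * Simple roots and polynomial families of matrices *)

Section CharPoly.
Variable F : fieldType.

Lemma horner_char_poly n (A : 'M[F]_n) x : (char_poly A).[x] = \det (x%:M - A).
Proof.
rewrite /char_poly -horner_evalE -det_map_mx; congr (\det _).
by apply/matrixP => i j; rewrite !mxE /= /horner_eval !hornerE hornerMn hornerX.
Qed.

Lemma simple_root_deriv (p : {poly F}) a : p != 0 -> mup a p = 1%N ->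
  p.[a] = 0 /\ p^`().[a] != 0.
Proof.
move=> p0 m1.
have : 'X - a%:P %| p by rewrite XsubC_dvd// m1.
move=> /dvdpP[q pq]; split; first by rewrite pq !hornerE subrr mulr0.
rewrite pq derivM derivXsubC !hornerE subrr mulr0 add0r.
apply/negP => /eqP qa.
have /dvdpP[r qr] : 'X - a%:P %| q by rewrite dvdp_XsubCl; apply/rootP.
have : (2 <= mup a p)%N by rewrite mup_geq// pq qr -mulrA -expr2 dvdp_mull.
by rewrite m1.
Qed.

Lemma lin_mx_scaled_sum m n p q (f g h : 'M[F]_(m, n) -> 'M[F]_(p, q)) a : a != 0 ->
  (forall B, h B = a *: f B + a^-1 *: g B) ->
  a *: lin_mx h = a ^+ 2 *: lin_mx f + lin_mx g.
Proof.
move=> a0 hE; apply/matrixP => i j; rewrite !mxE /= hE linearD !linearZ /= !mxE.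
by rewrite mulrDr !mulrA -expr2 mulfV// mul1r.
Qed.

Lemma horner_quadratic_mx m n (X Y : 'M[F]_(m, n)) a :
  map_mx (horner_eval a) ('X^2 *: map_mx polyC X + map_mx polyC Y) = a ^+ 2 *: X + Y.
Proof. by apply/matrixP => i j; rewrite !mxE /= /horner_eval !hornerE. Qed.

End CharPoly.

Section EigenvectorFamily.
Variables (R : realType) (n : nat).
Local Notation C := R[i].
Context (T : Type) (F : set_system T) {FF : Filter F}.

(** Dividing by p'(1) normalises the cofactor vector so that it tends to [v] itself, not merely to a
    multiple of it. *)
Lemma eigenvector_limit (Wp : 'M[{poly C}]_n.+1) (s y : T -> C) s0 v :
  let W a := map_mx (horner_eval a) Wp in
  ccvg F s s0 -> ccvg F y 1 -> W s0 *m v = v -> (char_poly (W s0))^`().[1] != 0 ->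
  exists2 u : T -> 'cV[C]_n.+1, mccvg F u v &
    forall x, (char_poly (W (s x))).[y x] = 0 -> W (s x) *m u x = y x *: u x.
Proof.
move=> W sc yc Wv d0; set d := _.[1] in d0.
exists (fun x => d^-1 *: cofactor_vec (char_poly (W (s x))) (W (s x)) (y x) v).
  have Wc : mccvg F (fun x => W (s x)) (W s0).
    move=> i j; rewrite mxE horner_evalE; under eq_fun do rewrite mxE horner_evalE.
    exact: ccvg_horner.
  have cc : mccvg F (fun x => cofactor_vec (char_poly (W (s x))) (W (s x)) (y x) v)
      (cofactor_vec (char_poly (W s0)) (W s0) 1 v).
    apply: mccvg_cofactor_vec; [|move=> j|exact: Wc|exact: yc].
      by move=> x; rewrite !size_char_poly.
    rewrite -map_char_poly coef_map /= horner_evalE.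
    under eq_fun do rewrite -map_char_poly coef_map /= horner_evalE.
    exact: ccvg_horner.
  have vE : d^-1 *: cofactor_vec (char_poly (W s0)) (W s0) 1 v = v.
    by rewrite (cofactor_vec_fixed _ Wv) scalerA mulVf ?scale1r.
  rewrite -[X in mccvg _ _ X]vE; exact: mccvgZ.
move=> x r0; rewrite -scalemxAr char_poly_cofactor_vec; last exact/rootP.
by rewrite !scalerA mulrC.
Qed.

End EigenvectorFamily.

(** * Existence and regularity of the principal root *)

Section PrincipalRoot.
Variables (R : realType) (U : 'M[R[i]]_2) (m : nat) (A : 'I_m -> 'M[R[i]]_2).
Local Notation C := R[i].
Hypothesis (U_unitary : U \is unitarymx) (A_unital : unital_measurement A).
Variable k : R.
Hypothesis simple1 : alg_multiplicity 1 (superop_mx U A k k) = 1%N.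
Local Notation M x := (superop_mx U A k (k + x)).

Definition shift_part (P : 'M[C]_2) : 'M[C]_(2 * 2) :=
  lin_mx (fun B => superop U A k k B *m P).

(* Multiplied by [cexpi x], the matrix of [superop U A k (k + x)] becomes
   polynomial in [cexpi x]. *)
Definition shift_poly_mx : 'M[{poly C}]_(2 * 2) :=
  'X^2 *: map_mx polyC (shift_part (PR R)) + map_mx polyC (shift_part (PL R)).

Lemma shift_poly_mxE x :
  map_mx (horner_eval (cexpi x)) shift_poly_mx = cexpi x *: M x.
Proof.
rewrite horner_quadratic_mx; apply/esym/lin_mx_scaled_sum; first exact: cexpi_neq0.
by move=> B; exact: superop_shift2.
Qed.

(** The outer variable is the eigenvalue of [cexpi x *: M x]; the inner one stands for [cexpi x]. *)
Definition char_poly2 : {poly {poly C}} := char_poly shift_poly_mx.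

Lemma char_poly2E x : map_poly (horner_eval (cexpi x)) char_poly2 =
  char_poly (cexpi x *: M x).
Proof. by rewrite map_char_poly shift_poly_mxE. Qed.

Lemma char_poly2_horner x y :
  char_poly2.[y%:P].[cexpi x] = (char_poly (cexpi x *: M x)).[y].
Proof. by rewrite -horner_eval_map char_poly2E. Qed.

Lemma char_poly2_root x z : z != 0 ->
  (char_poly2.[(cexpi x / z)%:P].[cexpi x] == 0) = (\det (1%:M - z *: M x) == 0).
Proof.
move=> z0; rewrite char_poly2_horner horner_char_poly.
have -> : (cexpi x / z)%:M - cexpi x *: M x = (cexpi x / z) *: (1%:M - z *: M x).
  by rewrite scalerBr scalerA divfK// scalemx1.
by rewrite detZ mulf_eq0 expf_eq0 mulf_eq0 invr_eq0 (negbTE z0) (negbTE (cexpi_neq0 x)).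
Qed.

Lemma M0 : cexpi 0 *: M 0 = superop_mx U A k k.
Proof. by rewrite cexpi0 scale1r addr0. Qed.

Lemma char_poly2_simple :
  char_poly2.[1%:P].[cexpi 0] = 0 /\ char_poly2^`().[1%:P].[cexpi 0] != 0.
Proof.
have [r1 r2] := simple_root_deriv (monic_neq0 (char_poly_monic _)) simple1.
by rewrite -!horner_eval_map -deriv_map char_poly2E M0.
Qed.

Lemma principal_root_exists : exists z, principal_root U A k z.
Proof.
have [r1 r2] := char_poly2_simple.
(* The degree 4 is the dimension of L(H_2). The implicit function is y = e^{ix} / z, from which z is
   recovered below. *)
have [|||y [y0 yr yc]] := @implicit_exists R char_poly2 (@cexpi R) 4 1 0 _ _ _ r1 r2.
- by move=> nu; rewrite char_poly2E char_poly_monic.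
- by move=> nu; rewrite char_poly2E size_char_poly.
- by move=> nu; exact: cdiff_cvg (cdiff_cexpi nu).
have yn0 : \forall nu \near (0 : R), y nu != 0.
  apply: ccvg_neq0 (nbhs_singleton yc) _; by rewrite y0 oner_neq0.
exists (fun x => cexpi x / y x); split.
- by rewrite cexpi0 y0 divr1.
- near=> x; have y0' : y x != 0 by near: x.
  have e : y x = cexpi x / (cexpi x / y x).
    by rewrite invf_div mulrCA mulfV ?mulr1// cexpi_neq0.
  have r : char_poly2.[(y x)%:P].[cexpi x] = 0 by near: x.
  apply/eqP; rewrite -char_poly2_root ?mulf_neq0 ?invr_eq0 ?cexpi_neq0//.
  by rewrite -e r.
- near=> x; apply/ccvgE; apply: ccvgM; first exact: cdiff_cvg (cdiff_cexpi x).
  by apply: ccvgV; near: x.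
Unshelve. all: by end_near. Qed.

Section Root.
Variable z : R -> C.
Hypothesis zP : principal_root U A k z.

Lemma principal_root0 : z 0 = 1. Proof. by case: zP. Qed.

Lemma principal_root_cvg : \forall x \near (0 : R), ccvg (nbhs x) z (z x).
Proof. by case: zP => _ _; apply: filterS => x /ccvgE. Qed.

Lemma principal_root_neq0 : \forall x \near (0 : R), z x != 0.
Proof.
apply: ccvg_neq0 (nbhs_singleton principal_root_cvg) _.
by rewrite principal_root0 oner_neq0.
Qed.

Lemma principal_root_char : \forall x \near (0 : R),
  char_poly2.[(cexpi x / z x)%:P].[cexpi x] = 0.
Proof.
have [_ zr _] := zP; have zn0 := principal_root_neq0.
near=> x; apply/eqP; rewrite char_poly2_root; last by near: x.
by apply/eqP; near: x.
Unshelve. all: by end_near. Qed.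

Lemma c2diff_cexpi x : c2diff (@cexpi R) x.
Proof.
exists (fun y => 'i * cexpi y); first by near=> y; exact: cdiff_cexpi.
by eexists; apply: cdiffM; [exact: cdiff_cst|exact: cdiff_cexpi].
Unshelve. all: by end_near. Qed.

(** For any admissible [z], the quotient e^{ix} / z is a continuous root of [char_poly2] through the
    simple root 1, so it inherits two derivatives; z is e^{ix} over that quotient. *)
Lemma principal_root_c2diff : c2diff z 0.
Proof.
have [r1 r2] := char_poly2_simple.
have zn0 := principal_root_neq0; have zc := principal_root_cvg.
have y0 : cexpi 0 / z 0 = 1 by rewrite cexpi0 principal_root0 divr1.
have yc2 : c2diff (fun x => cexpi x / z x) 0.
  have dsd : cdiff (fun x : R => 'i * cexpi x) 0 (0 * cexpi 0 + 'i * ('i * cexpi 0)).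
    by apply: cdiffM; [exact: cdiff_cst|exact: cdiff_cexpi].
  apply: implicit_c2diff (@cdiff_cexpi R) dsd _ principal_root_char _; last by rewrite y0.
  near=> x; apply: ccvgM; first exact: cdiff_cvg (cdiff_cexpi x).
  by apply: ccvgV; near: x.
apply: (@near_eq_c2diff _ (fun x => cexpi x * (cexpi x / z x)^-1)).
  near=> x; have z0 : z x != 0 by near: x.
  by rewrite invf_div mulrCA mulfV ?mulr1// cexpi_neq0.
by apply: c2diffM; [exact: c2diff_cexpi|apply: c2diffV; rewrite ?y0 ?oner_neq0].
Unshelve. all: by end_near. Qed.

(** At x = 0 trace preservation makes [trvec R] the fixed vector; the factor e^{ix} that made the
    family polynomial is cancelled at the end. *)
Lemma principal_root_eigenvector : exists2 u : R -> 'cV[C]_(2 * 2),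
  mccvg (nbhs (0 : R)) u (trvec R) &
  \forall x \near (0 : R), M x *m u x = (z x)^-1 *: u x.
Proof.
have zn0 := principal_root_neq0; have zr := principal_root_char.
have yc : ccvg (nbhs (0 : R)) (fun x => cexpi x / z x) 1.
  have -> : 1 = cexpi 0 / z 0 by rewrite cexpi0 principal_root0 divr1.
  apply: ccvgM; first exact: cdiff_cvg (cdiff_cexpi _).
  by apply: ccvgV; [exact: nbhs_singleton zn0|exact: nbhs_singleton principal_root_cvg].
have [r1 r2] := simple_root_deriv (monic_neq0 (char_poly_monic _)) simple1.
have [||u uc uE] := @eigenvector_limit R 3 _ (nbhs (0 : R)) _ shift_poly_mx
    (@cexpi R) (fun x => cexpi x / z x) (cexpi 0) (trvec R) (cdiff_cvg (cdiff_cexpi _)) yc.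
- by rewrite shift_poly_mxE M0 superop_mx_trvec.
- by rewrite shift_poly_mxE M0.
exists u => //; near=> x.
have := uE x; rewrite shift_poly_mxE -char_poly2_horner => h.
have : (cexpi x *: M x) *m u x = (cexpi x / z x) *: u x by apply: h; near: x.
rewrite -scalemxAl -scalerA => /(congr1 (fun v => (cexpi x)^-1 *: v)).
by rewrite !scalerA mulVf ?cexpi_neq0// scale1r mulrA mulVf ?cexpi_neq0// mul1r.
Unshelve. all: by end_near. Qed.

End Root.
End PrincipalRoot.

Lemma Re_divr (R : realType) (w : R[i]) (r : R) :
  complex.Re (w / r%:C) = complex.Re w / r.
Proof. by rewrite -fmorphV cReM /= mulr0 subr0. Qed.

Lemma Im_divr (R : realType) (w : R[i]) (r : R) :
  complex.Im (w / r%:C) = complex.Im w / r.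
Proof. by rewrite -fmorphV cImM /= mulr0 add0r. Qed.

(** * The limit for a fixed momentum k *)

Section PointwiseLimit.
Variables (R : realType) (U : 'M[R[i]]_2) (m : nat) (A : 'I_m -> 'M[R[i]]_2).
Local Notation C := R[i].
Hypothesis (U_unitary : U \is unitarymx) (A_unital : unital_measurement A).
Variable k : R.
Hypothesis simple1 : alg_multiplicity 1 (superop_mx U A k k) = 1%N.
Local Notation M x := (superop_mx U A k (k + x)).
Variable z : R -> C.
Hypothesis zP : principal_root U A k z.

(** 1 / z(x) is an eigenvalue of the superoperator, which does not increase the Hilbert-Schmidt norm
    of its eigenvector. *)
Lemma principal_root_inv_le1 : \forall x \near (0 : R), normc (z x)^-1 <= 1.
Proof.
have zn0 := principal_root_neq0 zP; have [_ zd _] := zP.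
near=> x; have z0 : z x != 0 by near: x.
have d0 : \det (1%:M - z x *: M x) = 0 by near: x.
have : root (char_poly (M x)) (z x)^-1.
  apply/rootP; rewrite horner_char_poly.
  have -> : (z x)^-1%:M - M x = (z x)^-1 *: (1%:M - z x *: M x).
    by rewrite scalerBr scalerA mulVf// scale1r scalemx1.
  by rewrite detZ d0 mulr0.
rewrite -eigenvalue_root_char => /eigenvalueP[v vM v0].
have Lv : superop U A k (k + x) (vec_mx v) = (z x)^-1 *: vec_mx v.
  by apply: (can_inj mxvecK); rewrite -mul_superop_mx linearZ /= vec_mxK vM.
have := superop_contraction U_unitary A_unital k (k + x) (vec_mx v).
rewrite Lv hsnorm2Z -[leRHS]mul1r ler_pM2r; last first.
  rewrite lt_def hsnorm2_ge0 andbT; apply: contra v0 => /eqP/hsnorm2_eq0 h.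
  by rewrite -(vec_mxK v) h linear0.
rewrite expr_le1 ?normr_ge0// => h.
by rewrite -normc_le.
Unshelve. all: by end_near. Qed.

(* Pairing the eigenvector equation with the identity operator, which
   [superop U A k (k + x)] maps to [shiftmx (- x)]. *)
Lemma principal_root_trace (u : 'cV[C]_(2 * 2)) x :
  M x *m u = (z x)^-1 *: u ->
  cexpi x * u (mxvec_index 0 0) 0 + (cexpi x)^-1 * u (mxvec_index 1 1) 0 =
  (z x)^-1 * (u (mxvec_index 0 0) 0 + u (mxvec_index 1 1) 0).
Proof.
move=> uE; have : mxvec 1%:M *m (M x *m u) = mxvec 1%:M *m ((z x)^-1 *: u) by rewrite uE.
rewrite mulmxA mul_superop_mx superop_shift superop_id// mul1mx -scalemxAr.
rewrite -PR_PL -(scale1r (PR R)) -(scale1r (PL R)) /shiftmx opprK cexpiNV.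
rewrite mxvec_diag_mul (mxvec_diag_mul 1 1) scale_scalar_mx 2!mul1r => /matrixP/(_ 0 0).
by rewrite !mxE !mulr1n.
Qed.

Lemma principal_root_deriv0 d : cdiff z 0 d -> d = 0.
Proof.
move=> zd; have [u uc uE] := principal_root_eigenvector U_unitary A_unital simple1 zP.
have z0 : z 0 = 1 by exact: principal_root0 zP.
have zVd : cdiff (fun x => (z x)^-1) 0 (- d / z 0 ^+ 2).
  by apply: cdiffV; rewrite ?z0 ?oner_neq0.
have eVd : cdiff (fun x : R => (cexpi x)^-1) 0 (- ('i * cexpi 0) / cexpi 0 ^+ 2).
  by apply: cdiffV; [exact: cexpi_neq0|exact: cdiff_cexpi].
have [h1 h1c h1E] := zVd; have [s1 s1c s1E] := cdiff_cexpi (0 : R); have [s2 s2c s2E] := eVd.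
pose a x := u x (mxvec_index 0 0) 0; pose b x := u x (mxvec_index 1 1) 0.
have t00 : trvec R (mxvec_index 0 0) 0 = 1 by rewrite mxE mxvecE mxE.
have t11 : trvec R (mxvec_index 1 1) 0 = 1 by rewrite mxE mxvecE mxE.
have ac : ccvg (nbhs (0 : R)) a 1 by rewrite -t00; exact: uc.
have bc : ccvg (nbhs (0 : R)) b 1 by rewrite -t11; exact: uc.
(* The eigenvector is only known to be continuous at 0, so the trace identity cannot be
   differentiated. Its zeroth-order terms cancel exactly, leaving x phi(x) = 0 with phi made of
   slopes. *)
pose phi x := s1 x * a x + s2 x * b x - h1 x * (a x + b x).
have phic : ccvg (nbhs (0 : R)) phi (2 * d).
  have -> : 2 * d = 'i * cexpi 0 * 1 + - ('i * cexpi 0) / cexpi 0 ^+ 2 * 1 -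
      (- d / z 0 ^+ 2) * (1 + 1).
    rewrite cexpi0 z0 expr1n !divr1 !mulr1; ring.
  by apply: ccvgB; [apply: ccvgD; exact: ccvgM|apply: ccvgM => //; exact: ccvgD].
have phi0 : \forall x \near (0 : R)^', phi x = 0.
  have H : \forall x \near (0 : R), phi x * x%:C = 0.
    near=> x.
    have uEx : M x *m u x = (z x)^-1 *: u x by near: x.
    have e1 : (z x)^-1 = (z 0)^-1 + h1 x * (x - 0)%:C by near: x.
    have e2 : cexpi x = cexpi 0 + s1 x * (x - 0)%:C by near: x.
    have e3 : (cexpi x)^-1 = (cexpi 0)^-1 + s2 x * (x - 0)%:C by near: x.
    have := principal_root_trace uEx.
    rewrite -/(a x) -/(b x) e1 e2 -e2 e3 e2 z0 cexpi0 invr1 subr0 => e4.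
    have -> : phi x * x%:C = ((1 + s1 x * x%:C) * a x + (1 + s2 x * x%:C) * b x)
        - (1 + h1 x * x%:C) * (a x + b x) by rewrite /phi; ring.
    by rewrite e4 subrr.
  have H' : \forall x \near (0 : R)^', phi x * x%:C = 0 by apply: cvg_within.
  near=> x; have x0 : x != 0 by near: x; exact: nbhs_dnbhs_neq.
  have : phi x * x%:C = 0 by near: x.
  move/eqP; rewrite mulf_eq0 => /orP[/eqP//|].
  by rewrite eq_complex /= (negbTE x0).
have phic' : ccvg (0 : R)^' phi (2 * d).
  have sub : id @ (0 : R)^' --> nbhs (0 : R).
    by move=> B; apply: (@cvg_within _ (nbhs (0 : R))).
  exact: (ccvg_comp sub phic).
have phi0' : ccvg (0 : R)^' phi 0.
  apply: (near_eq_ccvg (f := fun=> 0)); last exact: ccvg_cst.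
  by near=> x; apply/esym; near: x.
have d2 : 2 * d = 0 by exact: ccvg_unique phic' phi0'.
by move/eqP: d2; rewrite mulf_eq0 pnatr_eq0 /= => /eqP.
Unshelve. all: by end_near. Qed.

Lemma principal_root_taylor :
  ccvg (0 : R)^' (fun x => (z x - 1) / (x ^+ 2)%:C) (cderive2 z 0 / 2).
Proof.
have z2 := principal_root_c2diff simple1 zP.
have [twr twi] := c2diff_ctwice_derivable z2.
have [dz zd _] := z2; have zd0 := nbhs_singleton zd.
have d0 := principal_root_deriv0 zd0; rewrite d0 in zd0.
have [[_ rd] [_ id]] := proj1 (cdiffP _ _ _) zd0.
have tr := taylor2 twr (etrans (derive1E _ _) rd).
have ti := taylor2 twi (etrans (derive1E _ _) id).
have z0 : z 0 = 1 by exact: principal_root0 zP.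
split.
  rewrite -[2]/(2%:R) natC Re_divr /=; under eq_fun do rewrite Re_divr !ReImE.
  by rewrite z0 in tr.
rewrite -[2]/(2%:R) natC Im_divr /=; under eq_fun do rewrite Im_divr !ReImE.
by rewrite z0 in ti.
Qed.

(* The evolution of [B] splits along the eigenvector [u eps_t] of the dual
   operator; the remainder is paired with [trvec R - u eps_t], which tends to 0,
   while the iterates stay bounded, so that no spectral gap is needed. *)
Lemma trace_iter_cvg (B : 'M[C]_2) (nu : R) : \tr B = 1 ->
  ccvg \oo (fun t => \tr (iter t (superop U A k (k + nu / Num.sqrt t%:R)) B))
    (cexp (- 2^-1 * cderive2 z 0 * (nu ^+ 2)%:C)).
Proof.
move=> B1; set c := - 2^-1 * _ * _.
pose eps (t : nat) : R := nu / Num.sqrt t%:R.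
have epsc : eps t @[t --> \oo] --> (0 : R).
  have -> : eps = (fun t : nat => nu * Num.sqrt (t%:R^-1)).
    by apply/funext => t; rewrite /eps sqrtrV.
  rewrite -(mulr0 nu); apply: cvgM; first exact: cvg_cst.
  rewrite -(sqrtr0 R); apply: continuous_cvg; first exact: sqrt_continuous.
  exact: cvg_invn.
have zE := principal_root_inv_le1.
have [u uc uE] := principal_root_eigenvector U_unitary A_unital simple1 zP.
have z0 : z 0 = 1 by exact: principal_root0 zP.
have zc : ccvg (nbhs (0 : R)) z 1.
  by rewrite -z0; exact: nbhs_singleton (principal_root_cvg zP).
pose w t := (z (eps t))^-1.
have w1 : \forall t \near \oo, normc (w t) <= 1 by exact: epsc zE.
have zepsc : ccvg \oo (z \o eps) 1 by exact: ccvg_comp epsc zc.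
have wc : ccvg \oo (fun t => t%:R * (w t - 1)) c.
  (* The Taylor quotient lives on a punctured neighbourhood of 0, which [eps] enters only for
     nonzero [nu]. *)
  have [nu0|nu0] := eqVneq nu 0.
    have -> : c = 0 by rewrite /c nu0 expr0n mulr0.
    apply: (near_eq_ccvg (f := fun=> 0)); last exact: ccvg_cst.
    by near=> t; rewrite /w /eps nu0 mul0r z0 invr1 subrr mulr0.
  have epsc' : eps t @[t --> \oo] --> (0 : R)^'.
    move=> V V0; have V0' : \forall t \near \oo, eps t != 0 -> V (eps t) by exact: epsc V0.
    suff : \forall t \near \oo, V (eps t) by [].
    near=> t; have : eps t != 0 -> V (eps t) by near: t.
    apply; rewrite /eps mulf_neq0// invr_eq0 sqrtr_eq0 -ltNge ltr0n.
    by near: t; exact: nbhs_infty_gt.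
  have tc := ccvg_comp epsc' principal_root_taylor.
  (* With eps^2 = nu^2 / t, the quantity t (1/z - 1) equals -nu^2 (z - 1) / eps^2 / z; the limit is
     written in the same shape. *)
  have -> : c = (- (nu ^+ 2)%:C * (cderive2 z 0 / 2)) / 1 by rewrite /c; field.
  apply: (near_eq_ccvg (f := fun t =>
      (- (nu ^+ 2)%:C * ((z (eps t) - 1) / (eps t ^+ 2)%:C)) / z (eps t))).
    near=> t.
    have t0 : (0 < t)%N by near: t; exact: nbhs_infty_gt.
    have zn0 : z (eps t) != 0.
      by near: t; exact: (epsc _ (principal_root_neq0 zP)).
    have -> : (eps t ^+ 2)%:C = (nu ^+ 2)%:C / t%:R.
      by rewrite /eps exprMn exprVn sqr_sqrtr ?ler0n// rmorphM fmorphV natC.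
    rewrite /w; field.
    rewrite zn0 pnatr_eq0 -lt0n t0 /=.
    by rewrite eq_complex /= eqxx andbT.
  apply: ccvgM; first by apply: ccvgM; [exact: ccvg_cst|exact: tc].
  by apply: ccvgV; [exact: oner_neq0|exact: zepsc].
have [c0 wtc] := ccvg_pow_cexp w1 wc.
pose X t := iter t (superop U A k (k + eps t)) B.
have uec : mccvg \oo (u \o eps) (trvec R).
  by move=> i j; exact: (ccvg_comp epsc (uc i j)).
have -> : cexp c = cexp c * (mxvec B *m trvec R) 0 0 + 0.
  by rewrite mxvec_trvec B1 mxE eqxx mulr1 addr0.
apply: (near_eq_ccvg (f := fun t => w t ^+ t * (mxvec B *m (u (eps t))) 0 0 +
    (mxvec (X t) *m (trvec R - u (eps t))) 0 0)).
  near=> t; have uEt : M (eps t) *m u (eps t) = w t *: u (eps t).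
    by near: t; exact: epsc uE.
  have := mul_iter_superop_mx B t uEt; rewrite -/(X t) => e.
  rewrite mulmxBr e mxvec_trvec; move: (mxvec B *m _) => Y.
  by rewrite !mxE eqxx mulr1n; ring.
apply: ccvgD.
  apply: ccvgM => //; apply: mccvgM => // i j; exact: ccvg_cst.
pose K : R := Num.sqrt (complex.Re (hsnorm2 B)).
have -> : (fun t => (mxvec (X t) *m (trvec R - u (eps t))) 0 0) =
    (fun t => \sum_(i < 2 * 2) mxvec (X t) 0 i * (trvec R - u (eps t)) i 0).
  by apply/funext => t; rewrite mxE.
rewrite [X in ccvg _ _ X](_ : _ = \sum_(i < 2 * 2) 0 :> C); last by rewrite big1.
apply: ccvg_sum => i _.
apply: (ccvg_squeeze (g := fun t => K * normc (trvec R i 0 - u (eps t) i 0))).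
  rewrite -(mulr0 K); apply: cvgM; first exact: cvg_cst.
  rewrite -(normc0 R) -(subrr (trvec R i 0)); apply: ccvg_normc.
  by apply: ccvgB; [exact: ccvg_cst|exact: uec].
near=> t; rewrite subr0 normcM [X in _ * normc X]mxE [X in _ * normc (_ + X)]mxE.
rewrite ler_wpM2r ?normc_ge0//.
case/mxvec_indexP: i => i j; rewrite mxvecE.
exact: normc_iter_entry.
Unshelve. all: by end_near. Qed.




End PointwiseLimit.

(** * Finitely supported sums over the integers *)

Section FiniteSupport.
Variables (V : zmodType) (I : Type).

Lemma sum_delta_seq (r : seq I) (a : I -> int) (F : I -> int -> V) (s : seq int) :
  uniq s -> {subset map a r <= s} ->
  \sum_(z <- s) (\sum_(i <- r) if z == a i then F i z else 0) =
  \sum_(i <- r) F i (a i).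
Proof.
move=> us; elim: r => [|i r IH] rs.
  by rewrite big_nil big1// => z _; rewrite big_nil.
under eq_bigr do rewrite big_cons.
rewrite big_split /= IH; last by move=> z zr; apply: rs; rewrite inE zr orbT.
rewrite big_cons; congr (_ + _).
rewrite (bigD1_seq (a i))//=; last by apply: rs; rewrite mem_head.
by rewrite eqxx big1 ?addr0// => z /negbTE ->.
Qed.

(** Every sum over [int] below is brought to this form, as point masses indexed by a list; a single
    mass uses the list [[:: tt]]. *)
Lemma fsum_delta (r : seq I) (a : I -> int) (F : I -> int -> V) :
  \sum_(z \in [set: int]) (\sum_(i <- r) if z == a i then F i z else 0) =
  \sum_(i <- r) F i (a i).
Proof.
rewrite (fsbigE (undup (map a r)))//=; last 2 first.
- exact: undup_uniq.
- move=> z _; rewrite mem_undup; elim: r => [|i r IH]; first by rewrite big_nil.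
  by rewrite inE big_cons negb_or => /andP[/negbTE -> /IH ->]; rewrite addr0.
rewrite -(sum_delta_seq F (undup_uniq (map a r))) => [|z]; last by rewrite mem_undup.
by apply: eq_bigl => z; apply/mem_set.
Qed.

End FiniteSupport.

(** * Fourier representation of the walk *)

Section Fourier.
Variables (R : realType) (U : 'M[R[i]]_2) (m : nat) (A : 'I_m -> 'M[R[i]]_2).
Local Notation C := R[i].
Local Notation item := (int * int * 'M[C]_2)%type.
Implicit Types (rho : kernel_op R) (l : seq item) (b c : bool).

(* [true] stands for a step to the right, taken in the coin state R. *)
Definition dir b : int := if b then 1 else -1.
Definition cproj b : 'M[C]_2 := if b then PR R else PL R.

(* A list represents the sum of the operators |x><y| (x) B over its items. *)
Definition represents rho l := forall x y, rho x y =
  \sum_(e <- l) if (x == e.1.1) && (y == e.1.2) then e.2 else 0.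

(** The momentum block of the represented operator. The sign is that of [Uk]: a right step of the
    first position contributes e^{-ik}. *)
Definition fourier l (k k' : R) : 'M[C]_2 :=
  \sum_(e <- l) cexpi (k' * e.1.2%:~R - k * e.1.1%:~R) *: e.2.

(** Left and right factors of the conjugation choose their directions independently, so each item
    gives rise to one item per pair of directions and Kraus index. *)
Definition step_list l : seq item :=
  [seq (e.1.1 + dir p.1.1, e.1.2 + dir p.1.2,
    (cproj p.1.1 *m U *m A p.2) *m e.2 *m (cproj p.1.2 *m U *m A p.2)^t*) |
    e <- l, p <- index_enum (bool * bool * 'I_m)%type].

Lemma fsum_delta_bool (V : zmodType) (x : int) (F : bool -> int -> V) :
  \sum_(z \in [set: int]) (\sum_b if x == z + dir b then F b z else 0) =
  \sum_b F b (x - dir b).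
Proof.
rewrite -(fsum_delta _ (fun b => x - dir b)); apply: eq_fsbigr => z _.
by apply: eq_bigr => b _; rewrite -subr_eq eq_sym.
Qed.

Lemma walkE_blocks x y :
  walkE U x y = \sum_b if x == y + dir b then cproj b *m U else 0.
Proof.
rewrite /walkE /kmul /tensor /pos_id.
transitivity (\sum_(z \in [set: int]) \sum_(i <- [:: tt]) if z == y then
    Defs.kadd (tensor (@pos_shiftp R) (PR R)) (tensor (@pos_shiftm R) (PL R)) x z *m U else 0).
  apply: eq_fsbigr => z _; rewrite big_seq1; case: eqP => _.
    by rewrite scale1r.
  by rewrite scale0r mulmx0.
rewrite (fsum_delta _ (fun=> y) (fun _ z => Defs.kadd _ _ x z *m U)) big_seq1.
rewrite big_bool /= /Defs.kadd /tensor /pos_shiftp /pos_shiftm mulmxDl; congr (_ + _).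
  by case: eqP => _; rewrite ?scale1r// scale0r mul0mx.
by case: eqP => _; rewrite ?scale1r// scale0r mul0mx.
Qed.

Lemma kmul_tensor_id (K : kernel_op R) B x y :
  kmul K (tensor (@pos_id R) B) x y = K x y *m B.
Proof.
transitivity (\sum_(z \in [set: int]) \sum_(i <- [:: tt]) if z == y then K x z *m B else 0).
  apply: eq_fsbigr => z _; rewrite big_seq1 /tensor /pos_id; case: eqP => _.
    by rewrite scale1r.
  by rewrite scale0r mulmx0.
by rewrite (fsum_delta _ (fun=> y) (fun _ z => K x z *m B)) big_seq1.
Qed.

Lemma kadj_tensor_id B : kadj (tensor (@pos_id R) B) = tensor (@pos_id R) (B^t*).
Proof.
apply/funext => x; apply/funext => y; rewrite /kadj /tensor /pos_id eq_sym.
by case: eqP => _; rewrite ?scale1r// !scale0r trmx0 map_mx0.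
Qed.

Lemma step_blocks rho (n : 'I_m) x y :
  kmul (kmul (kmul (kmul (walkE U) (tensor (@pos_id R) (A n))) rho)
    (kadj (tensor (@pos_id R) (A n)))) (kadj (walkE U)) x y =
  \sum_b \sum_c (cproj b *m U *m A n) *m rho (x - dir b) (y - dir c) *m
    (cproj c *m U *m A n)^t*.
Proof.
have left z : kmul (kmul (walkE U) (tensor (@pos_id R) (A n))) rho x z =
    \sum_b (cproj b *m U *m A n) *m rho (x - dir b) z.
  rewrite -(fsum_delta_bool x (fun b w => (cproj b *m U *m A n) *m rho w z)).
  apply: eq_fsbigr => w _; rewrite kmul_tensor_id walkE_blocks !mulmx_suml.
  by apply: eq_bigr => b _; case: eqP => _ //; rewrite !mul0mx.
rewrite exchange_big /=.
rewrite -(fsum_delta_bool y (fun c w => \sum_b (cproj b *m U *m A n) *m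
  rho (x - dir b) w *m (cproj c *m U *m A n)^t*)).
apply: eq_fsbigr => w _.
rewrite kadj_tensor_id kmul_tensor_id left /kadj walkE_blocks trmxC_sum mulmx_sumr.
apply: eq_bigr => c _; case: eqP => _; last by rewrite trmx0 map_mx0 mulmx0.
by rewrite !mulmx_suml; apply: eq_bigr => b _; rewrite !trmxC_mul !mulmxA.
Qed.

Lemma represents_step rho l : represents rho l ->
  represents (walk_step U A rho) (step_list l).
Proof.
move=> rl x y; rewrite /walk_step.
under eq_bigr do rewrite step_blocks.
rewrite big_allpairs_dep [RHS]exchange_big /= exchange_big /=.
under eq_bigr do rewrite exchange_big /=.
rewrite pair_bigA /= pair_bigA /=; apply: eq_bigr => -[[b c] n] _ /=.
rewrite rl mulmx_sumr mulmx_suml; apply: eq_bigr => e _.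
by rewrite !subr_eq; case: ifP => _; rewrite ?mulmx0 ?mul0mx.
Qed.

Lemma shiftmx_sum k : shiftmx k = \sum_b cexpi (- k * (dir b)%:~R) *: cproj b.
Proof. by rewrite big_bool /= mulr1 mulrN1 opprK. Qed.

(** Translations become phases, and summing them over the directions rebuilds [shiftmx] on either
    side. *)
Lemma fourier_step l k k' :
  fourier (step_list l) k k' = superop U A k k' (fourier l k k').
Proof.
rewrite superopE; transitivity (\sum_(n < m) \sum_b \sum_c
    (cexpi (- k * (dir b)%:~R) *: (cproj b *m U *m A n)) *m
    fourier l k k' *m (cexpi (- k' * (dir c)%:~R) *: (cproj c *m U *m A n))^t*).
  rewrite /fourier big_allpairs_dep exchange_big /= [RHS]exchange_big /=.
  under [RHS]eq_bigr do rewrite exchange_big /=.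
  rewrite pair_bigA /= pair_bigA /=; apply: eq_bigr => -[[b c] n] _ /=.
  rewrite mulmx_sumr mulmx_suml; apply: eq_bigr => e _.
  rewrite trmxCZ conjC_conjc -cexpiN -!scalemxAl -!scalemxAr -scalemxAl.
  rewrite !scalerA -!cexpiD; congr (cexpi _ *: _).
  by rewrite !rmorphD /=; ring.
move: (fourier l k k') => B.
apply: eq_bigr => n _; rewrite !UkE !shiftmx_sum !mulmx_suml.
apply: eq_bigr => b _; rewrite trmxC_sum mulmx_sumr; apply: eq_bigr => c _.
by rewrite -!scalemxAl.
Qed.

(** One list serves all momenta at once; hence the integrand in k will be a trigonometric
    polynomial. *)
Lemma walk_state_list (Phi0 : 'cV[C]_2) t : exists l,
  represents (walk_state U A Phi0 t) l /\
  forall k k', fourier l k k' = iter t (superop U A k k') (Phi0 *m Phi0^t*).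
Proof.
elim: t => [|t [l [rl fl]]].
  exists [:: (0, 0, Phi0 *m Phi0^t*)]; split=> [x y|k k'].
    rewrite big_seq1 /= /tensor /pos_proj; case: ifP => _.
      by rewrite scale1r.
    by rewrite scale0r.
  by rewrite /fourier big_seq1 /= !mulr0 subrr cexpi0 scale1r.
exists (step_list l); split=> [|k k']; first exact: represents_step rl.
by rewrite fourier_step fl.
Qed.

Lemma char_fun_list (Phi0 : 'cV[C]_2) nu t l :
  represents (walk_state U A Phi0 t) l ->
  char_fun U A Phi0 nu t =
  \sum_(e <- l) if e.1.1 == e.1.2 then cexpi (nu * e.1.2%:~R) * \tr e.2 else 0.
Proof.
move=> rl.
have probE x : position_prob U A Phi0 x t = \tr (walk_state U A Phi0 t x x).
  rewrite /position_prob /ktrace.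
  transitivity (\sum_(z \in [set: int]) \sum_(i <- [:: tt]) if z == x then
      \tr (walk_state U A Phi0 t z z) else 0).
    apply: eq_fsbigr => z _; rewrite big_seq1 /kmul.
    transitivity (\tr (\sum_(w \in [set: int]) \sum_(i <- [:: tt]) if w == x then
      (if z == x then walk_state U A Phi0 t w z else 0) else 0)).
      congr (\tr _); apply: eq_fsbigr => w _; rewrite big_seq1 /tensor /pos_proj.
      case: eqP => _ /=; last by rewrite scale0r mul0mx; case: ifP.
      by case: eqP => _; rewrite ?scale1r ?mul1mx// scale0r mul0mx.
    rewrite (fsum_delta _ (fun=> x) (fun _ w => if z == x then _ else 0)) big_seq1.
    by case: eqP => [->//|_]; rewrite linear0.
  by rewrite (fsum_delta _ (fun=> x) (fun _ z => \tr (walk_state U A Phi0 t z z))) big_seq1.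
rewrite /char_fun -(fsum_delta l (fun e => e.1.2) (fun e x => if e.1.1 == x then
  cexpi (nu * x%:~R) * \tr e.2 else 0)).
apply: eq_fsbigr => x _; rewrite probE rl linear_sum /= mulr_sumr.
apply: eq_bigr => e _; rewrite [x == e.1.2]eq_sym [x == e.1.1]eq_sym.
by case: (e.1.1 == x); case: (e.1.2 == x) => //=; rewrite linear0 mulr0.
Qed.

End Fourier.

(** * Integrals of real functions *)

Section RealIntegrals.
Variable R : realType.
Local Notation mu := (@lebesgue_measure R).

Lemma Rintegral_FTC (f F : R -> R) a b : a < b -> continuous f ->
  (forall x : R, is_derive x 1 F (f x)) ->
  \int[mu]_(x in `[a, b]) f x = F b - F a.
Proof.
move=> ab fc dF; have cF : continuous F.
  move=> x; apply/differentiable_continuous/derivable1_diffP.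
  by have [] := dF x.
rewrite /Rintegral (@continuous_FTC2 R f F a b)//.
- exact: continuous_subspaceT.
- split.
  + by move=> x _; have [] := dF x.
  + by apply: cvg_at_right_filter; exact: cF.
  + by apply: cvg_at_left_filter; exact: cF.
- by move=> x _; rewrite derive1E; have [_ ->] := dF x.
Qed.

(** No regularity of [h] is assumed: it is measurable as a limit of continuous functions, and the
    constant [K] dominates on the bounded interval. *)
Lemma Rintegral_bounded_cvg (h_ : nat -> R -> R) (h : R -> R) (a b K : R) :
  (forall n, continuous (h_ n)) -> (forall n x, `|h_ n x| <= K) ->
  (forall x, a <= x <= b -> h_ n x @[n --> \oo] --> h x) ->
  mu.-integrable `[a, b] (fun x => (h x)%:E) /\
  \int[mu]_(x in `[a, b]) h_ n x @[n --> \oo] --> \int[mu]_(x in `[a, b]) h x.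
Proof.
move=> hc hK hh.
have mh n : measurable_fun `[a, b]%classic (EFin \o h_ n).
  apply/measurable_EFinP; apply: measurable_funTS; exact: continuous_measurable_fun.
have hh' x : `[a, b]%classic x -> (h_ n x)%:E @[n --> \oo] --> (h x)%:E.
  move=> /=; rewrite in_itv /= => xab; apply: cvg_EFin; last exact: hh.
  by near=> n.
have mh0 : measurable_fun `[a, b]%classic (EFin \o h).
  exact: (emeasurable_fun_cvg (fun n => EFin \o h_ n) _ mh hh').
have iK : mu.-integrable `[a, b] (EFin \o fun=> K).
  apply: (@continuous_compact_integrable R (fun=> K)); first exact: segment_compact.
  by apply: continuous_subspaceT => x; exact: cvg_cst.
have [] := @dominated_convergence _ _ R mu `[a, b]%classic (measurable_itv _)
  (fun n => EFin \o h_ n) (EFin \o h) (EFin \o fun=> K) mh mh0 _ iK _.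
- by apply: aeW => x; exact: hh'.
- by apply: aeW => x n _; rewrite /= lee_fin; exact: hK.
move=> ih _ lim.
split=> //; rewrite /Rintegral; apply: fine_cvg.
by rewrite fineK; [exact: lim|exact: integrable_fin_num].
Unshelve. all: by end_near. Qed.

End RealIntegrals.

(** * Trigonometric polynomials and their integrals over a period *)

Section TrigonometricPolynomials.
Variable R : realType.
Local Notation C := R[i].
Implicit Types (r : seq (C * int)).

Definition trigpoly r (k : R) : C := \sum_(p <- r) p.1 * cexpi (k * p.2%:~R).

Lemma cexpi_2piZ (n : int) : cexpi (2 * pi * n%:~R) = 1 :> C.
Proof.
have nat_case (j : nat) : cexpi (2 * pi * j%:R) = 1 :> C.
  elim: j => [|j IH]; first by rewrite mulr0 cexpi0.
  rewrite -[j.+1%:R]natr1 mulrDr cexpiD IH mulr1 mul1r cexpiE mulr_natl.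
  by rewrite cos2pi sin2pi.
case: n => n; first exact: nat_case.
by rewrite NegzE mulrNz mulrN cexpiNV nat_case invr1.
Qed.

Lemma cdiff_cexpiZ (a : R) x : cdiff (fun k => cexpi (k * a)) x (a%:C * 'i * cexpi (x * a)).
Proof.
have e (y : R) : cexpi (y * a) = cos (y * a) +i* sin (y * a) by exact: cexpiE.
apply/cdiffP; split; under eq_fun do rewrite e; rewrite !ReImE e /=.
  by apply: is_derive_eq; rewrite /GRing.scale /=; ring.
by apply: is_derive_eq; rewrite /GRing.scale /=; ring.
Qed.

Lemma cdiff_real x : cdiff (fun k : R => k%:C) x 1.
Proof.
exists (fun=> 1); first exact: ccvg_cst.
by near=> y; rewrite mul1r rmorphB /= addrC subrK.
Unshelve. all: by end_near. Qed.

Definition trigprim r (k : R) : C :=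
  \sum_(p <- r) p.1 * (if p.2 == 0 then k%:C else cexpi (k * p.2%:~R) / ((p.2%:~R)%:C * 'i)).

Lemma cdiff_sum (I : Type) (s : seq I) (F d : I -> R -> C) x :
  (forall i, cdiff (F i) x (d i x)) ->
  cdiff (fun k => \sum_(i <- s) F i k) x (\sum_(i <- s) d i x).
Proof.
move=> Fd; elim: s => [|i s IH].
  by rewrite big_nil; under eq_fun do rewrite big_nil; exact: cdiff_cst.
by rewrite big_cons; under eq_fun do rewrite big_cons; exact: cdiffD.
Qed.

Lemma cdiff_trigprim r x : cdiff (trigprim r) x (trigpoly r x).
Proof.
apply: (@cdiff_sum _ _ (fun p k => _) (fun p k => p.1 * cexpi (k * p.2%:~R))) => -[c n] /=.
have -> : c * cexpi (x * n%:~R) = 0 * (if n == 0 then x%:C else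
    cexpi (x * n%:~R) / ((n%:~R)%:C * 'i)) + c * cexpi (x * n%:~R) by rewrite mul0r add0r.
apply: cdiffM; first exact: cdiff_cst.
have [->|n0] := eqVneq n 0; first by rewrite mulr0 cexpi0; exact: cdiff_real.
have a0 : (n%:~R)%:C * 'i != 0 :> C.
  by rewrite mulf_neq0// eq_complex /= ?intr_eq0 ?(negbTE n0)// oner_eq0 andbF.
have -> : cexpi (x * n%:~R) = (n%:~R)%:C * 'i * cexpi (x * n%:~R) / ((n%:~R)%:C * 'i)
    + cexpi (x * n%:~R) * 0 by rewrite mulr0 addr0 mulrAC mulfV// mul1r.
by apply: cdiffM; [exact: cdiff_cexpiZ|exact: cdiff_cst].
Qed.

Lemma trigpoly_cdiff r x : exists d, cdiff (trigpoly r) x d.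
Proof.
eexists; apply: (@cdiff_sum _ _ (fun p k => p.1 * cexpi (k * p.2%:~R))
  (fun p k => 0 * cexpi (k * p.2%:~R) + p.1 * ((p.2%:~R)%:C * 'i * cexpi (k * p.2%:~R)))) => p.
by apply: cdiffM; [exact: cdiff_cst|exact: cdiff_cexpiZ].
Qed.

Lemma continuous_Re_trigpoly r : continuous (fun k => complex.Re (trigpoly r k)).
Proof. by move=> x; have [d /cdiff_cvg[]] := trigpoly_cdiff r x. Qed.

Lemma continuous_Im_trigpoly r : continuous (fun k => complex.Im (trigpoly r k)).
Proof. by move=> x; have [d /cdiff_cvg[]] := trigpoly_cdiff r x. Qed.

(** Primitives of nonzero frequencies are 2 pi-periodic and cancel; only frequency 0 contributes. *)
Lemma cintegral_trigpoly r : cintegral 0 (2 * pi) (trigpoly r) =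
  (2 * pi)%:C * \sum_(p <- r) if p.2 == 0 then p.1 else 0.
Proof.
have pi0 : 0 < 2 * pi :> R by rewrite mulr_gt0 ?pi_gt0.
have -> : (2 * pi)%:C * (\sum_(p <- r) if p.2 == 0 then p.1 else 0) =
    trigprim r (2 * pi) - trigprim r 0.
  rewrite mulr_sumr -sumrB; apply: eq_bigr => -[c n] _ /=; case: eqP => _.
    by rewrite rmorph0 mulr0 subr0 mulrC.
  by rewrite mul0r cexpi0 cexpi_2piZ subrr mulr0.
apply: complex_ext; rewrite !ReImE /=.
  apply: (Rintegral_FTC (F := fun k => complex.Re (trigprim r k))) => //.
    exact: continuous_Re_trigpoly.
  by move=> x; have /cdiffP[] := cdiff_trigprim r x.
apply: (Rintegral_FTC (F := fun k => complex.Im (trigprim r k))) => //.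
  exact: continuous_Im_trigpoly.
by move=> x; have /cdiffP[] := cdiff_trigprim r x.
Qed.

Lemma cintegral_bounded_cvg (r_ : nat -> seq (C * int)) (h : R -> C) a b (K : R) :
  (forall n x, normc (trigpoly (r_ n) x) <= K) ->
  (forall x, a <= x <= b -> ccvg \oo (fun n => trigpoly (r_ n) x) (h x)) ->
  cintegrable a b h /\
  ccvg \oo (fun n => cintegral a b (trigpoly (r_ n))) (cintegral a b h).
Proof.
move=> hK hh.
have [iRe cRe] := @Rintegral_bounded_cvg R (fun n x => complex.Re (trigpoly (r_ n) x))
  (fun x => complex.Re (h x)) a b K (fun n => @continuous_Re_trigpoly (r_ n))
  (fun n x => le_trans (Re_le_normc _) (hK n x)) (fun x xab => (hh x xab).1).
have [iIm cIm] := @Rintegral_bounded_cvg R (fun n x => complex.Im (trigpoly (r_ n) x))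
  (fun x => complex.Im (h x)) a b K (fun n => @continuous_Im_trigpoly (r_ n))
  (fun n x => le_trans (Im_le_normc _) (hK n x)) (fun x xab => (hh x xab).2).
by split; split.
Qed.

End TrigonometricPolynomials.

(** * The characteristic function as an integral over momenta *)

Section CharacteristicFunction.
Variables (R : realType) (U : 'M[R[i]]_2) (m : nat) (A : 'I_m -> 'M[R[i]]_2).
Variable Phi0 : 'cV[R[i]]_2.
Local Notation C := R[i].

(** For k' = k + nu, an item at (x, y) carries the phase e^{i nu y} e^{i k (y - x)}. Integration
    over k keeps the items with x = y, which are those seen by the position distribution. *)
Lemma char_fun_integral nu t : exists r : seq (C * int),
  (forall k, trigpoly r k = \tr (iter t (superop U A k (k + nu)) (Phi0 *m Phi0^t*))) /\
  char_fun U A Phi0 nu t = ((2 * pi)^-1)%:C * cintegral 0 (2 * pi) (trigpoly r).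
Proof.
have [l [rl fl]] := walk_state_list U A Phi0 t.
exists [seq (cexpi (nu * e.1.2%:~R) * \tr e.2, e.1.2 - e.1.1) | e <- l]; split=> [k|].
  rewrite -fl /trigpoly /fourier big_map linear_sum /=; apply: eq_bigr => e _.
  rewrite linearZ /= mulrAC -cexpiD; congr (cexpi _ * _).
  by rewrite rmorphB /=; ring.
rewrite (char_fun_list nu rl) cintegral_trigpoly big_map mulrA -rmorphM /= mulVf.
  rewrite mul1r; apply: eq_bigr => e _ /=.
  by rewrite subr_eq0 eq_sym.
by rewrite mulf_neq0// gt_eqF// pi_gt0.
Qed.

End CharacteristicFunction.

Theorem theorem3p1 (R : realType) (U : 'M[R[i]]_2) (m : nat)
    (A : 'I_m -> 'M[R[i]]_2) (Phi0 : 'cV[R[i]]_2)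
    (U_unitary : U \is unitarymx)
    (A_unital : unital_measurement A)
    (Phi0_unit : \sum_(j < 2) `|Phi0 j 0| ^+ 2 = 1)
    (one_simple : forall k : R, 0 <= k <= 2 * pi ->
       eigenvalue (superop_mx U A k k) 1 /\
       alg_multiplicity 1 (superop_mx U A k k) = 1%N)
    (others_lt1 : forall (k : R) (lambda : R[i]), 0 <= k <= 2 * pi ->
       eigenvalue (superop_mx U A k k) lambda -> lambda != 1 ->
       `|lambda| < 1) :
  (forall k : R, 0 <= k <= 2 * pi -> exists z, principal_root U A k z) /\
  (forall z0 : R -> R -> R[i],
     (forall k : R, 0 <= k <= 2 * pi -> principal_root U A k (z0 k)) ->
     (forall k : R, 0 <= k <= 2 * pi -> ctwice_derivable (z0 k) 0) /\
     (forall nu : R, 0 <= nu <= 2 * pi ->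
        let f := fun k : R =>
          cexp (- 2^-1 * cderive2 (z0 k) 0 * (nu ^+ 2)%:C) in
        cintegrable 0 (2 * pi) f /\
        (fun t : nat =>
           char_fun U A Phi0 (nu / Num.sqrt t%:R) t : R[i]^o) @ \oo -->
          (((2 * pi)^-1)%:C * cintegral 0 (2 * pi) f : R[i]^o))).
Proof.
split=> [k kI|z0 z0P].
  by have [_ s1] := one_simple k kI; exact: principal_root_exists s1.
split=> [k kI|nu _ f].
  have [_ s1] := one_simple k kI; apply: c2diff_ctwice_derivable.
  exact: (principal_root_c2diff s1 (z0P k kI)).
pose B := Phi0 *m Phi0^t*.
have B1 : \tr B = 1.
  rewrite -[RHS]Phi0_unit; apply: eq_bigr => j _.
  by rewrite mxE big_ord1 !mxE -normCK.
have [r rP] := choice (fun t => char_fun_integral U A Phi0 (nu / Num.sqrt t%:R) t).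
(* The trace has two diagonal entries, each bounded by [normc_iter_entry]. *)
pose K : R := 2 * Num.sqrt (complex.Re (hsnorm2 B)).
have rK t k : normc (trigpoly (r t) k) <= K.
  rewrite (rP t).1; apply: le_trans (normc_sum _ _ _) _.
  have -> : K = \sum_(i < 2) Num.sqrt (complex.Re (hsnorm2 B)).
    by rewrite sumr_const card_ord /K mulr_natl.
  by apply: ler_sum => i _; exact: normc_iter_entry.
have rf k : 0 <= k <= 2 * pi -> ccvg \oo (fun t => trigpoly (r t) k) (f k).
  move=> kI; have [_ s1] := one_simple k kI.
  have -> : (fun t => trigpoly (r t) k) =
      (fun t => \tr (iter t (superop U A k (k + nu / Num.sqrt t%:R)) B)).
    by apply/funext => t; rewrite (rP t).1.
  exact: trace_iter_cvg (z0P k kI) _ _ B1.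
have [fi fc] := cintegral_bounded_cvg rK rf.
split=> //; apply/ccvgE.
have -> : (fun t => char_fun U A Phi0 (nu / Num.sqrt t%:R) t) =
    (fun t => ((2 * pi)^-1)%:C * cintegral 0 (2 * pi) (trigpoly (r t))).
  by apply/funext => t; rewrite (rP t).2.
by apply: ccvgM; [exact: ccvg_cst|exact: fc].
Qed.
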